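(* Let $p$ be a prime and $G$ a totally disconnected locally compact (t.d.l.c.) group. Then $G$ is normed $p$-adic amenable if and only if it is locally elliptic and $p^\mathbb{N}$-free. In this case, $$\|G\|_p = \min\{p^k \geq 1 \mid G \text{ is } p^{k+1}\text{-free}\} = \max\{p^k \mid \text{there exist open subgroups } V \leq U \leq G \text{ with } p^k \mid [U:V]\}.$$
   Context: $C_b(G,\mathbb{Q}_p)$ is the space of continuous bounded functions $G\to\mathbb{Q}_p$ with sup norm (using the $p$-adic norm $|\cdot|_p$), with $G$ acting by $(g\cdot f)(x)=f(g^{-1}x)$. A normed $\mathbb{Q}_p$-mean on $G$ is a bounded linear map $m:C_b(G,\mathbb{Q}_p)\to\mathbb{Q}_p$ with $m(\mathbbm{1}_G)=1$; it is left-invariant if $m(g\cdot f)=m(f)$. $G$ is normed $p$-adic amenable if it admits a left-invariant normed $\mathbb{Q}_p$-mean, and $\|G\|_p$ is the infimum of the operator norms $\|m\|_{op}=\inf\{C\ge0:|m(f)|_p\le C\|f\|_\infty\ \forall f\}$ of such means ($\|G\|_p=\infty$ if none exists). $G$ is locally elliptic if every finite subset of $G$ is contained in a compact subgroup (equivalently, $G$ is a directed union of compact open subgroups). For an integer $n$, $G$ is $n$-free if for every pair of open subgroups $V\le U\le G$ with $[U:V]$ finite, $n$ does not divide $[U:V]$. $G$ is $p^\mathbb{N}$-free if it is $p^k$-free for some $k\ge1$. *)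

(* Defs.v *)
From HB Require Import structures.
From mathcomp Require Import all_boot all_order all_algebra.
From mathcomp Require Import all_classical all_reals all_analysis.
Set Implicit Arguments. Unset Strict Implicit. Unset Printing Implicit Defensive.
Import Order.TTheory GRing.Theory Num.Theory.
Local Open Scope classical_set_scope.
Local Open Scope ring_scope.

Definition padic_abs (R : realType) (p : nat) (q : rat) : R :=
  if q == 0 then 0
  else (p%:R ^+ logn p `|denq q|%N) / (p%:R ^+ logn p `|numq q|%N).

(* (K, nK) is a model of Q_p: a field with an absolute value nK that is
   non-archimedean, restricts to the p-adic absolute value on Q, is complete,
   and in which Q is dense.  Such a pair is unique up to a unique isometric
   field isomorphism (it is the completion of (Q, |.|_p)). *)
Record is_Qp (p : nat) (R : realType) (K : fieldType) (nK : K -> R) : Prop := {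
  Qp_ge0 : forall x, 0 <= nK x;
  Qp_norm0 : forall x, nK x = 0 <-> x = 0;
  Qp_normM : forall x y, nK (x * y) = nK x * nK y;
  Qp_ultra : forall x y, nK (x + y) <= Num.max (nK x) (nK y);
  Qp_onQ : forall q : rat, nK (ratr q) = padic_abs R p q;
  Qp_complete : forall u : nat -> K,
    (forall e : R, 0 < e -> exists N, forall m n, (N <= m)%N -> (N <= n)%N ->
        nK (u m - u n) < e) ->
    exists l, forall e : R, 0 < e -> exists N, forall n, (N <= n)%N ->
        nK (u n - l) < e;
  Qp_dense : forall (x : K) (e : R), 0 < e -> exists q : rat, nK (x - ratr q) < e
}.

Record tdlc_group (G : topologicalType) := {
  gmul : G -> G -> G;
  ginv : G -> G;
  gone : G;
  gmulA : forall x y z, gmul x (gmul y z) = gmul (gmul x y) z;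
  gmul1 : forall x, gmul gone x = x;
  gmulV : forall x, gmul (ginv x) x = gone;
  gmul_cont : continuous (fun xy : G * G => gmul xy.1 xy.2);
  ginv_cont : continuous ginv;
  g_hausdorff : hausdorff_space G;
  g_loc_compact : forall x : G, exists U : set G, nbhs x U /\ compact U;
  g_tot_disc : totally_disconnected [set: G]
}.

Section Groups.
Variables (G : topologicalType) (S : tdlc_group G).

Definition is_subgroup (H : set G) : Prop :=
  H (gone S) /\ (forall x y, H x -> H y -> H (gmul S x y)) /\ (forall x, H x -> H (ginv S x)).

Definition open_subgroup (H : set G) : Prop := is_subgroup H /\ open H.

Definition index_eq (U V : set G) (n : nat) : Prop :=
  exists f : 'I_n -> G,
    (forall i, U (f i)) /\
    (forall i j, V (gmul S (ginv S (f i)) (f j)) -> i = j) /\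
    (forall u, U u -> exists i, V (gmul S (ginv S (f i)) u)).

Definition locally_elliptic : Prop :=
  forall A : set G, finite_set A ->
    exists H : set G, is_subgroup H /\ compact H /\ A `<=` H.

Definition n_free (n : nat) : Prop :=
  forall (U V : set G) (m : nat), open_subgroup U -> open_subgroup V ->
    V `<=` U -> index_eq U V m -> ~ (n %| m)%N.

Definition pN_free (p : nat) : Prop := exists k, (1 <= k)%N /\ n_free (p ^ k).

Variables (R : realType) (K : fieldType) (nK : K -> R).

Definition contK (f : G -> K) : Prop :=
  forall (x : G) (e : R), 0 < e ->
    exists N : set G, nbhs x N /\ forall y, N y -> nK (f y - f x) < e.

Definition Cb (f : G -> K) : Prop :=
  contK f /\ exists B : R, forall x, nK (f x) <= B.

Definition supnorm (f : G -> K) : R := sup (range (fun x => nK (f x))).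

(* m is only relevant on C_b(G,K) *)
Definition normed_mean (m : (G -> K) -> K) : Prop :=
  (forall (a : K) f g, Cb f -> Cb g ->
      m (fun x => a * f x + g x) = a * m f + m g) /\
  (exists C : R, forall f, Cb f -> nK (m f) <= C * supnorm f) /\
  m (fun _ => 1) = 1.

Definition left_invariant (m : (G -> K) -> K) : Prop :=
  forall (g : G) f, Cb f -> m (fun x => f (gmul S (ginv S g) x)) = m f.

Definition inv_mean (m : (G -> K) -> K) : Prop := normed_mean m /\ left_invariant m.

Definition opnorm (m : (G -> K) -> K) : R :=
  inf [set C : R | 0 <= C /\ forall f, Cb f -> nK (m f) <= C * supnorm f].

Definition padic_amenable : Prop := exists m, inv_mean m.

(* ||G||_p, = +oo when no invariant mean exists *)
Definition normG : \bar R := ereal_inf [set (opnorm m)%:E | m in inv_mean].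

End Groups.

(* Main.v *)
Require Import Defs.
From HB Require Import structures.
From mathcomp Require Import all_boot all_order all_algebra.
From mathcomp Require Import all_classical all_reals all_analysis.
From mathcomp Require Import ring.
Import Order.TTheory GRing.Theory Num.Theory.
Local Open Scope classical_set_scope.
Local Open Scope ring_scope.
Set Implicit Arguments.
Unset Strict Implicit.
Unset Printing Implicit Defensive.

(* A mean bounded by C controls indices: if V has index n in U, the function 1
   is the sum of n translates of one indicator function, so |1/n|_p <= C.

   It forces local ellipticity: if finitely many elements and a compact open
   subgroup U generate a noncompact open subgroup, the graph of cosets Ux is
   locally finite with infinite components, so mass can be pushed along it to
   infinity by finitely many translations with finite backward orbits. Let N x
   be the number of points whose trajectory passes through x. Being integer
   valued, N is p-adically bounded, and 1 is N minus its push-forward, which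
   has the same mean as N: thus m 1 = 0.

   Conversely, given finitely many elements and functions, take a compact
   subgroup H containing the elements and a small open subgroup V normalized
   by H. Averaging over coset representatives of HV/V in H is almost invariant
   and has norm at most p^k when G is p^(k+1)-free; an ultrafilter limit of
   such averages exists since balls of Q_p are totally bounded. *)

(** * Compactness and totally disconnected spaces *)

(** The finite lists of points of [C], directed by inclusion, generate a filter; near-covering
    compactness along it yields one list that serves all points of [C] at once. *)
Lemma compact_finite_cover (T : topologicalType) (C : set T) (O : T -> set T) :
  compact C -> (forall x, C x -> nbhs x (O x)) ->
  exists s : seq T, (forall t, t \in s -> C t) /\
    forall x, C x -> exists2 t, t \in s & O t x.
Proof.
move=> /compact_near_coveringP cC nO.
pose sub (s : seq T) := forall t, t \in s -> C t.
pose F := filter_from sub (fun s => [set s' | sub s' /\ {subset s <= s'}]).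
have FF : Filter F.
  apply: filter_from_filter; first by exists [::] => ?; rewrite in_nil.
  move=> s1 s2 h1 h2; exists (s1 ++ s2).
    by move=> t; rewrite mem_cat => /orP[/h1|/h2].
  move=> s [hs h]; split; split => // t ht; apply: h; rewrite mem_cat ht ?orbT //.
have [|s hs sF] := cC _ F (fun s x => exists2 t, t \in s & O t x) FF.
  move=> x Cx; exists (O x, [set s | sub s /\ x \in s]).
    split => /=; first exact: nO.
    exists [:: x] => [t|s [hs h]]; first by rewrite inE => /eqP ->.
    by split => //; apply: h; rewrite inE.
  by move=> [x' s] [/= Ox' [_ xs]]; exists x.
by exists s; split => //; exact: (sF s (conj hs (fun=> id))).
Qed.

(** Regularity gives each point of [A] a neighborhood whose closure avoids [B]. Finitely many of
    their interiors cover [A], and [P2] is the complement of the closure of their union. *)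
Lemma compact_separation (T : topologicalType) (A B : set T) :
  hausdorff_space T -> (forall x : T, exists U : set T, nbhs x U /\ compact U) ->
  compact A -> compact B -> A `&` B = set0 ->
  exists P1 P2 : set T, [/\ open P1, open P2, A `<=` P1, B `<=` P2 &
    P1 `&` P2 = set0].
Proof.
move=> hT lcT cA cB AB0.
have W x : exists W : set T, A x -> nbhs x W /\ closure W `<=` ~` B.
  have [Ax|nAx] := pselect (A x); last by exists setT.
  have nB : nbhs x (~` B).
    apply: open_nbhs_nbhs; split.
      by apply: closed_openC; exact: compact_closed.
    by move=> Bx; have : (A `&` B) x by []; rewrite AB0.
  have [V [xV cV]] := lcT x.
  have [W ? ?] := compact_regular hT cV xV nB.
  by exists W.
have [W0 hW] := choice W.
have [s [sA hs]] := compact_finite_cover cA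
  (fun x Ax => nbhs_interior (hW x Ax).1).
have [P1 [oO1 O1B hO1]] : exists P1 : set T, [/\ open P1, closure P1 `<=` ~` B &
    forall t x, t \in s -> (W0 t)° x -> P1 x].
  elim: s sA {hs} => [_|t s IH sA].
    by exists set0; split => //; [exact: open0 | rewrite closure0].
  have [t' t's|P1 [oO1 O1B hO1]] := IH; first by apply: sA; rewrite inE t's orbT.
  exists ((W0 t)° `|` P1); split.
  - by apply: openU => //; exact: open_interior.
  - have [_ hB] := hW _ (sA t (mem_head _ _)).
    rewrite closureU subUset; split => //; apply: subset_trans hB.
    by apply: closureS; exact: interior_subset.
  - move=> t' x; rewrite inE => /orP[/eqP -> ?|ts ?]; [by left|right].
    exact: hO1 ts _.
exists P1, (~` closure P1); split => //.
- by apply: closed_openC; exact: closed_closure.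
- by move=> x /hs [t ts tx]; exact: hO1 tx.
- by move=> x Bx /O1B.
- by apply/disjoints_subset; rewrite setCK; exact: subset_closure.
Qed.

(* In a compact set [C] the intersection [Q] of the relatively clopen
   neighborhoods of [x] is connected, hence reduced to [x]. *)
Lemma compact_open_basis (T : topologicalType) (x : T) (O : set T) :
  hausdorff_space T -> (forall x : T, exists U : set T, nbhs x U /\ compact U) ->
  totally_disconnected [set: T] -> nbhs x O ->
  exists D : set T, [/\ D x, open D, compact D & D `<=` O].
Proof.
move=> hT lcT tdT xO.
have [C [xC cC]] := lcT x.
have clC := compact_closed hT cC.
pose DD := [set D : set T | [/\ D x, closed D & exists2 W, open W & D = C `&` W]].
have DDC : DD C.
  by split => //; [exact: nbhs_singleton|exists setT; [exact: openT|rewrite setIT]].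
have DDI D1 D2 : DD D1 -> DD D2 -> DD (D1 `&` D2).
  move=> [? ? [W1 ? e1]] [? ? [W2 ? e2]]; split => //; first exact: closedI.
  by exists (W1 `&` W2); [exact: openI | rewrite e1 e2 setIACA setIid].
pose Q := \bigcap_(D in DD) D.
(* Since [DD] is stable under finite intersections, compactness of the part of [C] outside [W] puts
   a single member of [DD] inside [W]. *)
have small W : open W -> Q `<=` W -> exists2 D, DD D & D `<=` W.
  move=> oW QW.
  have /compact_near_coveringP cCW : compact (C `&` ~` W).
    by apply: compact_closedI => //; exact: open_closedC.
  pose F := filter_from DD (fun D => [set D' | DD D' /\ D' `<=` D]).
  have FF : Filter F.
    apply: filter_from_filter; first by exists C.
    move=> D1 D2 h1 h2; exists (D1 `&` D2); first exact: DDI.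
    by move=> D [hD DD12]; split; split => // z /DD12 [].
  have [|D hD sF] := cCW _ F (fun D y => ~ D y) FF.
    move=> y [Cy Wy].
    have [D hD Dy] : exists2 D, DD D & ~ D y.
      apply: contrapT => h; apply: Wy; apply: QW => D hD.
      by apply: contrapT => nDy; apply: h; exists D.
    have [_ cD _] := hD.
    exists (~` D, [set D' | DD D' /\ D' `<=` D]) => /=.
      by split; [apply: open_nbhs_nbhs; split => //; exact: closed_openC|exists D].
    by move=> [z D'] [/= Dz [_ D'D]] /D'D.
  exists D => // z Dz; apply: contrapT => nWz; apply: (sF D (conj hD (fun=> id)) z _ Dz).
  by split => //; have [_ _ [W' _ e]] := hD; move: Dz; rewrite e => -[].
have Qx : Q x by move=> E; case.
have clQ : closed Q by apply: closed_bigI => E; case.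
have QC : Q `<=` C by move=> y /(_ _ DDC).
(* Disjoint open sets [P1] and [P2] separate [B] from the rest of [Q], and some member of [DD] lies
   in their union. Its half around [x] is again in [DD], so all of [Q] lies in that half. *)
have Qcon : connected Q.
  move=> B [b Bb] [W1 oW BW] [K clK BK].
  have cQ : compact Q by exact: subclosed_compact cC QC.
  have cB : compact B by rewrite BK; exact: compact_closedI.
  have cB' : compact (Q `&` ~` W1) by apply: compact_closedI => //; exact: open_closedC.
  have [|P1 [P2 [oO1 oO2 BO1 BO2 O12]]] := compact_separation hT lcT cB cB'.
    by rewrite -subset0 => z [+ [_ nWz]]; rewrite BW => -[].
  have [|D hD DO] := small _ (openU oO1 oO2).
    move=> z Qz; have [Wz|nWz] := pselect (W1 z); [left; apply: BO1|right; exact: BO2].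
    by rewrite BW.
  have disj z : P1 z -> P2 z -> False.
    by move=> h1 h2; have : (P1 `&` P2) z by []; rewrite O12.
  have [Dx clD [WD oWD DE]] := hD.
  have half (V1 V2 : set T) : open V1 -> open V2 -> D `<=` V1 `|` V2 -> V1 x ->
      (forall z, V1 z -> V2 z -> False) -> DD (D `&` V1).
    move=> o1 o2 hP V1x h12; split => //; last first.
      by exists (WD `&` V1); [exact: openI|rewrite DE setIA].
    rewrite (_ : D `&` V1 = D `&` ~` V2).
      by apply: closedI => //; exact: open_closedC.
    apply/seteqP; split => z [Dz h]; split => //; first by move=> /(h12 _ h).
    by have [] := hP _ Dz.
  have [P1x|P2x] := DO _ Dx.
    have h := half _ _ oO1 oO2 DO P1x disj.
    rewrite BW; apply/seteqP; split => [z []//|z Qz]; split => //.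
    apply: contrapT => nWz; apply: (disj z); first by have [] := Qz _ h.
    by apply: BO2.
  have h : DD (D `&` P2).
    by apply: half oO2 oO1 _ P2x _ => [|z ? ?]; [rewrite setUC|exact: (disj z)].
  exfalso; apply: (disj b); first exact: BO1.
  have Qb : Q b by move: Bb; rewrite BW => -[].
  by have [] := Qb _ h.
have Q1 y : Q y -> y = x.
  move=> Qy; have := tdT x I; move/seteqP => [/(_ y) + _]; apply.
  by exists Q.
(* Keeping [D] inside the interior of [C] turns its relative openness in [C] into openness in
   [T]. *)
have [|D [Dx clD [W oW DE]] DO] := small (O `&` C)° (open_interior _).
  by move=> y /Q1 ->; exact: (filterI xO xC).
exists D; split => //.
- rewrite (_ : D = (O `&` C)° `&` W); first by apply: openI => //; exact: open_interior.
  apply/seteqP; split => z; first by move=> Dz; split; [exact: DO|move: Dz; rewrite DE => -[]].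
  by move=> [/interior_subset [_ Cz] Wz]; rewrite DE.
- by apply: subclosed_compact cC _ => //; rewrite DE => z [].
- by move=> z /DO /interior_subset [].
Qed.

(** * Group laws, open subgroups and cosets *)

Section GroupTheory.
Variables (G : topologicalType) (S : tdlc_group G).
Local Notation "x • y" := (gmul S x y) (at level 40, left associativity).
Local Notation inv := (ginv S).
Local Notation e := (gone S).

Lemma gmulgV x : x • inv x = e.
Proof.
rewrite -[LHS](gmul1 S) -{1}(gmulV S (inv x)) -!gmulA (gmulA S (inv x)).
by rewrite gmulV gmul1 gmulV.
Qed.

Lemma gmulg1 x : x • e = x.
Proof. by rewrite -(gmulV S x) gmulA gmulgV gmul1. Qed.

Lemma gmulK x y : x • y • inv y = x.
Proof. by rewrite -gmulA gmulgV gmulg1. Qed.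

Lemma gmulKV x y : x • inv y • y = x.
Proof. by rewrite -gmulA gmulV gmulg1. Qed.

Lemma ginvK x : inv (inv x) = x.
Proof. by rewrite -[LHS]gmulg1 -(gmulV S x) gmulA gmulV gmul1. Qed.

Lemma ginvM x y : inv (x • y) = inv y • inv x.
Proof.
by rewrite -[RHS](gmul1 S) -(gmulV S (x • y)) !gmulA !gmulK.
Qed.

Lemma ginv1 : inv e = e.
Proof. by rewrite -[LHS]gmulg1 gmulV. Qed.

(** Rewriting with these rules associates a group word to the left and cancels adjacent inverses. *)
Definition gE := (ginvM, ginvK, ginv1, gmul1, gmulg1, gmulV, gmulgV,
  gmulK, gmulKV, gmulA S).

Lemma nbhs_gmul2 x y (A : set G) : nbhs (x • y) A ->
  \forall x' \near x & y' \near y, A (x' • y').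
Proof. exact: (@gmul_cont _ S (x, y)). Qed.

Lemma nbhs_gmull a x (A : set G) : nbhs (a • x) A -> nbhs x (fun y => A (a • y)).
Proof.
move=> /nbhs_gmul2 [[A1 A2] [/= h1 h2] h]; apply: filterS h2 => y A2y.
by apply: (h (a, y)); split => //; exact: nbhs_singleton.
Qed.

Lemma nbhs_gmulr a x (A : set G) : nbhs (x • a) A -> nbhs x (fun y => A (y • a)).
Proof.
move=> /nbhs_gmul2 [[A1 A2] [/= h1 h2] h]; apply: filterS h1 => y A2y.
by apply: (h (y, a)); split => //; exact: nbhs_singleton.
Qed.

Lemma nbhs_ginv x (A : set G) : nbhs (inv x) A -> nbhs x (fun y => A (inv y)).
Proof. exact: (@ginv_cont _ S x). Qed.

Lemma continuous_gmulr a : continuous (fun x => x • a).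
Proof. by move=> x A; exact: nbhs_gmulr. Qed.

Lemma open_subgroup_of_nbhs (H : set G) :
  is_subgroup S H -> nbhs e H -> open_subgroup S H.
Proof.
move=> sH nH; split => //; rewrite openE => x Hx; rewrite /interior.
have [_ [HM _]] := sH.
have : nbhs x (fun y => H (inv x • y)) by apply: nbhs_gmull; rewrite gmulV.
apply: filterS => y Hy; have -> : y = x • (inv x • y) by rewrite !gE.
exact: HM.
Qed.

Lemma open_subgroup_nbhs (H : set G) : open_subgroup S H -> nbhs e H.
Proof. by move=> [[H1 _] oH]; exact: open_nbhs_nbhs. Qed.

Lemma open_subgroup_lcoset (H : set G) x : open_subgroup S H ->
  nbhs x (fun y => H (inv x • y)).
Proof.
by move=> oH; apply: nbhs_gmull; rewrite gmulV; exact: open_subgroup_nbhs.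
Qed.

Lemma open_subgroup_rcoset (H : set G) x : open_subgroup S H ->
  nbhs x (fun y => H (y • inv x)).
Proof.
by move=> oH; apply: nbhs_gmulr; rewrite gmulgV; exact: open_subgroup_nbhs.
Qed.

Lemma open_subgroup_closed (H : set G) : open_subgroup S H -> closed H.
Proof.
move=> oH x clx; have [[_ [HM HV]] _] := oH.
have [y [Hy Hxy]] := clx _ (open_subgroup_lcoset x oH).
have -> : x = y • inv (inv x • y) by rewrite !gE.
by apply: HM => //; exact: HV.
Qed.

Lemma open_subgroupT : open_subgroup S setT.
Proof. by split; [|exact: openT]. Qed.

(* The right stabilizer of a compact open neighborhood of the identity is an
   open subgroup. *)
Lemma van_Dantzig (A : set G) : nbhs e A ->
  exists V, [/\ open_subgroup S V, compact V & V `<=` A].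
Proof.
move=> nA.
have [D [De oD cD DA]] := compact_open_basis (g_hausdorff S) (g_loc_compact S)
  (g_tot_disc S) nA.
(* Asking for [inv g] as well builds stability under inverses into [V]. *)
pose V := [set g | forall d, D d -> D (d • g) /\ D (d • inv g)].
have VD : V `<=` D by move=> g /(_ _ De) []; rewrite gmul1.
have sV : is_subgroup S V.
  split; [|split].
  - by move=> d Dd; rewrite ginv1 gmulg1.
  - move=> x y Vx Vy d Dd; rewrite ginvM !gmulA; split.
      by have [] := Vy _ (Vx _ Dd).1.
    by have [] := Vx _ (Vy _ Dd).2.
  - by move=> x Vx d Dd; rewrite ginvK; have [] := Vx _ Dd.
have oV : open_subgroup S V.
  apply: open_subgroup_of_nbhs => //.
  have /compact_near_coveringP cD' := cD.
  apply: (cD' _ (nbhs e) (fun g d => D (d • g) /\ D (d • inv g))) => d Dd.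
  have nD : nbhs d D by exact: open_nbhs_nbhs.
  have h1 : \forall d' \near d & g \near e, D (d' • g).
    by apply: nbhs_gmul2; rewrite gmulg1.
  have [[B1 B2] [/= n1 n2] h2] : \forall d' \near d & g \near e, D (d' • g).
    by apply: nbhs_gmul2; rewrite gmulg1.
  apply: filterI => //.
  exists (B1, fun g => B2 (inv g)).
    by split => //=; apply: nbhs_ginv; rewrite ginv1.
  by move=> [d' g] [/= b1 b2]; exact: (h2 (d', inv g)).
exists V; split => //; last exact: subset_trans VD DA.
exact: subclosed_compact (open_subgroup_closed oV) cD VD.
Qed.

Section Subgroup.
Variable U : set G.
Hypothesis sU : is_subgroup S U.

Lemma subgroup1 : U e. Proof. by have [] := sU. Qed.

Lemma subgroupM x y : U x -> U y -> U (x • y).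
Proof. by have [_ [h _]] := sU; exact: h. Qed.

Lemma subgroupV x : U x -> U (inv x).
Proof. by have [_ [_ h]] := sU; exact: h. Qed.

Lemma subgroupMl x y : U x -> U (x • y) <-> U y.
Proof.
move=> Ux; split; last exact: subgroupM.
by move=> /(subgroupM (subgroupV Ux)); rewrite gmulA gmulV gmul1.
Qed.

(** A representative of the right coset [U x]. For a subgroup [U] the search succeeds, since [x]
    lies in its own coset, and the choice depends only on the coset. The fixed points of this map
    serve as the points of the coset space. *)
Definition crep (x : G) : G := xget e [set y | U (y • inv x)].

Lemma crepP x : U (crep x • inv x).
Proof.
by apply: (@xgetPex _ e [set y | U (y • inv x)]); exists x; rewrite /= gmulgV; exact: subgroup1.
Qed.

Lemma crep_eq x y : U (y • inv x) -> crep y = crep x.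
Proof.
move=> Uyx; rewrite /crep; congr xget; apply/seteqP; split => z /= Uz.
  have -> : z • inv x = (z • inv y) • (y • inv x) by rewrite !gE.
  exact: subgroupM.
have -> : z • inv y = (z • inv x) • inv (y • inv x) by rewrite !gE.
by apply: subgroupM => //; exact: subgroupV.
Qed.

Lemma crep_id x : crep (crep x) = crep x.
Proof. by apply: crep_eq; exact: crepP. Qed.

Lemma crepV x : U (x • inv (crep x)).
Proof. by have := subgroupV (crepP x); rewrite !gE. Qed.

End Subgroup.

End GroupTheory.

(** * Ultrafilter limits and the field of p-adic numbers *)

Lemma ultra_finite_choice (I : Type) (F : set_system I) (T : eqType) (s : seq T)
    (P : T -> set I) : UltraFilter F ->
  F [set i | exists2 c, c \in s & P c i] -> exists2 c, c \in s & F (P c).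
Proof.
move=> UF; elim: s => [|c s IH] h.
  have [i [c]] : [set i | exists2 c, c \in [::] & P c i] !=set0 by exact: filter_ex h.
  by rewrite in_nil.
have [Fc|Fc] := in_ultra_setVsetC (P c) UF; first by exists c; rewrite ?inE ?eqxx.
have [|c' c's Fc'] := IH; last by exists c' => //; rewrite inE c's orbT.
apply: filterS (filterI h Fc) => i [[c' ]]; rewrite inE => /orP[/eqP -> //|c's Pc' _].
by exists c'.
Qed.

Section Padic.
Variables (p : nat) (R : realType) (K : fieldType) (nK : K -> R).
Hypotheses (hp : prime p) (hK : is_Qp p nK).

Let nK_ge0 := Qp_ge0 hK.
Let nKM := Qp_normM hK.

Lemma Qp_abs0 : nK 0 = 0.
Proof. exact/(Qp_norm0 hK). Qed.

Lemma Qp_abs1 : nK 1 = 1.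
Proof.
have n0 : nK 1 != 0 by apply/eqP => /(Qp_norm0 hK)/eqP; rewrite oner_eq0.
by apply: (mulfI n0); rewrite -nKM !mulr1.
Qed.

Lemma Qp_absN x : nK (- x) = nK x.
Proof.
have h : nK (-1) ^+ 2 = 1 by rewrite expr2 -nKM mulrNN mulr1 Qp_abs1.
have h1 : nK (-1) = 1.
  by apply/eqP; move/eqP: h; rewrite sqrp_eq1 // nK_ge0.
by rewrite -mulN1r nKM h1 mul1r.
Qed.

Lemma Qp_absB x y : nK (x - y) <= Num.max (nK x) (nK y).
Proof. by rewrite -[nK y]Qp_absN; exact: (Qp_ultra hK). Qed.

Lemma Qp_absC x y : nK (x - y) = nK (y - x).
Proof. by rewrite -Qp_absN opprB. Qed.

Lemma Qp_absD_le (B : R) x y : nK x <= B -> nK y <= B -> nK (x + y) <= B.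
Proof.
by move=> hx hy; apply: le_trans (Qp_ultra hK x y) _; rewrite ge_max hx.
Qed.

Lemma Qp_absD_lt (B : R) x y : nK x < B -> nK y < B -> nK (x + y) < B.
Proof.
by move=> hx hy; apply: le_lt_trans (Qp_ultra hK x y) _; rewrite gt_max hx.
Qed.

Lemma Qp_abs_sum (I : Type) (r : seq I) (P : pred I) (F : I -> K) (B : R) :
  0 <= B -> (forall i, P i -> nK (F i) <= B) -> nK (\sum_(i <- r | P i) F i) <= B.
Proof.
move=> B0 h; apply: (big_ind (fun x => nK x <= B)) => //.
  by rewrite Qp_abs0.
by move=> x y; exact: Qp_absD_le.
Qed.

Lemma Qp_abs_nat_le1 n : nK n%:R <= 1.
Proof.
elim: n => [|n IH]; first by rewrite Qp_abs0.
by rewrite -natr1; apply: Qp_absD_le => //; rewrite Qp_abs1.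
Qed.

Lemma Qp_abs_int_le1 (z : int) : nK z%:~R <= 1.
Proof.
case: z => n; first exact: Qp_abs_nat_le1.
by rewrite NegzE mulrNz Qp_absN; exact: Qp_abs_nat_le1.
Qed.

Lemma Qp_abs_nat n : (0 < n)%N -> nK n%:R = (p%:R ^+ logn p n)^-1.
Proof.
move=> n0; have -> : n%:R = ratr (n%:R : rat) :> K by rewrite ratr_nat.
rewrite (Qp_onQ hK) /padic_abs pnatr_eq0 gtn_eqF //.
have -> : (n%:R : rat) = (n%:Z)%:~R by [].
by rewrite numq_int denq_int /= logn1 expr0 div1r.
Qed.

Lemma Qp_nat_neq0 n : (0 < n)%N -> n%:R != 0 :> K.
Proof.
move=> n0; apply/eqP => /(Qp_norm0 hK)/eqP; rewrite Qp_abs_nat // invr_eq0.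
by apply/negP; rewrite expf_neq0 // pnatr_eq0 -lt0n prime_gt0.
Qed.

Lemma Qp_absV x : nK x^-1 = (nK x)^-1.
Proof.
have [->|x0] := eqVneq x 0; first by rewrite invr0 Qp_abs0 invr0.
have nx0 : nK x != 0 by apply: contra_neq x0 => /(Qp_norm0 hK).
by apply: (mulfI nx0); rewrite -nKM !divff // Qp_abs1.
Qed.

Lemma exists_expn_gt (x : R) : exists n, x < p%:R ^+ n.
Proof.
exists (Num.bound `|x|).
have h : `|x| < (Num.bound `|x|)%:R by apply: archi_boundP.
apply: le_lt_trans (ler_norm x) _; apply: lt_trans h _.
by rewrite -natrX ltr_nat ltn_expl // prime_gt1.
Qed.

(* A rational [a / b] that is [p]-integral is congruent to [a b'] modulo
   [p ^ M], where [b'] is an inverse of [b] modulo [p ^ M]. *)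
Lemma Qp_rat_residue (q : rat) (M : nat) : nK (ratr q) <= 1 ->
  exists2 c, (c < p ^ M)%N & nK (ratr q - c%:R) <= (p%:R ^+ M)^-1.
Proof.
move=> q1; have p0 := prime_gt0 hp; have p1 := prime_gt1 hp.
have pM0 : (0 < p ^ M)%N by rewrite expn_gt0 p0.
have [q0|qn0] := eqVneq q 0.
  by exists 0 => //; rewrite q0 (ratr_nat K 0) subrr Qp_abs0 invr_ge0 exprn_ge0.
pose a := numq q; pose b := `|denq q|%N.
have b0 : (0 < b)%N by rewrite absz_gt0 denq_neq0.
have bE : denq q = b%:Z by rewrite /b gtz0_abs // denq_gt0.
have qE : ratr q = a%:~R / b%:R :> K by rewrite /ratr bE.
(* A factor [p] in the denominator would make the absolute value exceed 1. *)
have pb : coprime p b.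
  rewrite prime_coprime //; apply/negP => pdb.
  move: q1; rewrite (Qp_onQ hK) /padic_abs (negbTE qn0).
  have -> : logn p `|numq q| = 0.
    apply/eqP; rewrite -leqn0 leqNgt logn_gt0 mem_primes; apply/negP => /and3P[_ _ pda].
    have := coprime_num_den q; rewrite /coprime => /eqP ab.
    by have := dvdn_gcd p `|numq q| b; rewrite ab pda pdb dvdn1 gtn_eqF.
  rewrite expr0 divr1 leNgt => /negP; apply.
  by rewrite exprn_egt1 ?ltr1n // -lt0n logn_gt0 mem_primes hp b0.
have nb : nK b%:R = 1.
  rewrite Qp_abs_nat // lognE hp b0 /=.
  by move: pb; rewrite prime_coprime // => /negbTE ->; rewrite expr0 invr1.
have [u [v uv]] : exists u v, (b * u = v * p ^ M + 1)%N.
  have bpM : coprime (p ^ M) b by rewrite coprimeXl.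
  case: (egcdnP (p ^ M) b0) => u v uv _; exists u; exists v.
  by rewrite mulnC uv; move: bpM; rewrite /coprime gcdnC => /eqP ->.
pose z := (a * u%:Z)%R; pose P := (p ^ M)%:Z.
have P0 : P != 0 by rewrite /P gt_eqF // ltz_nat.
pose c := `|(z %% P)%Z|%N; pose w := (z %/ P)%Z.
have cE : c%:Z = (z %% P)%Z by rewrite /c gez0_abs // modz_ge0.
have zE : z = w * P + c%:Z by rewrite cE -divz_eq.
exists c; first by rewrite -ltz_nat cE ltz_pmod // ltz_nat.
(* This combines [b u = v P + 1] with [a u = w P + c]. Dividing by [b], of absolute value 1, then
   keeps the estimate. *)
have E : a - c%:Z * b%:Z = P * (w * b%:Z - a * v%:Z).
  have -> : c%:Z = z - w * P by rewrite zE addrC addKr.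
  have uv' : b%:Z * u%:Z = v%:Z * P + 1 by rewrite /P -!PoszM uv PoszD.
  rewrite /z mulrBl -mulrA [u%:Z * _]mulrC uv'; ring.
have -> : ratr q - c%:R = (P * (w * b%:Z - a * v%:Z))%:~R / b%:R :> K.
  have bK : b%:R != 0 :> K by exact: Qp_nat_neq0.
  by rewrite -E qE rmorphB rmorphM /= mulrBl -!pmulrn mulfK.
rewrite nKM Qp_absV nb invr1 mulr1 rmorphM nKM /= -pmulrn Qp_abs_nat //.
rewrite pfactorK // ler_piMr ?invr_ge0 ?exprn_ge0 //.
exact: Qp_abs_int_le1.
Qed.

(** Multiplication by [p ^ N] brings the ball of radius [C] into the unit ball, where residues
    modulo [p ^ (N + M)] form a net. Scaling back multiplies the error by [p ^ N], which leaves
    [p ^ (- M)], smaller than [e]. *)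
Lemma Qp_ball_net (C e : R) : 0 < e ->
  exists s : seq K, forall x, nK x <= C -> exists2 c, c \in s & nK (x - c) < e.
Proof.
move=> e0; have p0 : 0 < p%:R :> R by rewrite ltr0n prime_gt0.
have [N CN] := exists_expn_gt C; have [M eM] := exists_expn_gt (e^-1).
have pK : p%:R != 0 :> K by rewrite Qp_nat_neq0 // prime_gt0.
have npX k : nK (p%:R ^+ k) = (p%:R ^+ k)^-1.
  by rewrite -natrX Qp_abs_nat ?expn_gt0 ?prime_gt0 // pfactorK.
exists [seq c%:R / p%:R ^+ N | c <- iota 0 (p ^ (N + M))] => x xC.
have [|q hq] := Qp_dense hK (p%:R ^+ N * x) (e := (p%:R ^+ (N + M))^-1).
  by rewrite invr_gt0 exprn_gt0.
have pNM1 : (p%:R ^+ (N + M))^-1 <= 1 :> R.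
  by rewrite invf_le1 ?exprn_gt0 // exprn_ege1 // ler1n prime_gt0.
have xp : nK (p%:R ^+ N * x) <= 1.
  by rewrite nKM npX mulrC ler_pdivrMr ?exprn_gt0 // mul1r (le_trans xC) // ltW.
have [|c cM hc] := @Qp_rat_residue q (N + M).
  rewrite (_ : ratr q = (p%:R ^+ N * x) - (p%:R ^+ N * x - ratr q)); last by rewrite opprB addrC subrK.
  apply: le_trans (Qp_absB _ _) _; rewrite ge_max xp /=.
  exact: le_trans (ltW hq) pNM1.
exists (c%:R / p%:R ^+ N); first by apply: map_f; rewrite mem_iota.
have -> : x - c%:R / p%:R ^+ N = (p%:R ^+ N * x - c%:R) / p%:R ^+ N.
  by rewrite mulrBl mulrAC divff ?mul1r // expf_neq0.
rewrite nKM Qp_absV npX invrK.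
have h : nK (p%:R ^+ N * x - c%:R) <= (p%:R ^+ (N + M))^-1.
  rewrite (_ : _ - _ = (p%:R ^+ N * x - ratr q) + (ratr q - c%:R)); last by rewrite addrA subrK.
  by apply: Qp_absD_le => //; exact: ltW.
apply: (@le_lt_trans _ _ ((p%:R ^+ (N + M))^-1 * p%:R ^+ N)).
  by rewrite ler_pM2r ?exprn_gt0.
rewrite exprD invfM mulrAC mulVf ?mul1r ?gt_eqF ?exprn_gt0 //.
by rewrite invf_plt ?posrE ?exprn_gt0.
Qed.

(** For each radius 1/(n+1) the pigeonhole principle on a finite net selects a center [u n]. Two
    sets of the ultrafilter always meet, so the centers form a Cauchy sequence; its limit is the
    required one. *)
Lemma Qp_ultra_lim (I : Type) (F : set_system I) (phi : I -> K) (C : R) :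
  UltraFilter F -> F [set i | nK (phi i) <= C] ->
  exists l, forall e : R, 0 < e -> F [set i | nK (phi i - l) < e].
Proof.
move=> UF hC.
have near_cst n : exists c, F [set i | nK (phi i - c) < n.+1%:R^-1].
  have [|s hs] := @Qp_ball_net C n.+1%:R^-1; first by rewrite invr_gt0 ltr0n.
  have [|c _ Fc] := @ultra_finite_choice _ F _ s (fun c => [set i | nK (phi i - c) < n.+1%:R^-1]) UF.
    by apply: filterS hC => i; exact: hs.
  by exists c.
have [u hu] := choice near_cst.
have inv_small (e : R) : 0 < e -> exists N, forall n, (N <= n)%N -> n.+1%:R^-1 < e.
  move=> e0; exists (Num.bound e^-1) => n Nn.
  rewrite invf_plt ?posrE ?ltr0n //; apply: lt_le_trans (archi_boundP _) _.
    by rewrite invr_ge0 ltW.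
  by rewrite ler_nat; exact: leq_trans Nn (leqnSn _).
have [|l hl] := Qp_complete hK (u := u).
  move=> e /inv_small [N hN]; exists N => m n Nm Nn.
  have [i [/= h1 h2]] := filter_ex (filterI (hu m) (hu n)).
  have -> : u m - u n = (phi i - u n) - (phi i - u m) by ring.
  apply: Qp_absD_lt; last rewrite Qp_absN.
    exact: lt_trans h2 (hN _ Nn).
  exact: lt_trans h1 (hN _ Nm).
exists l => e e0; have [N hN] := inv_small _ e0; have [N' hN'] := hl _ e0.
apply: filterS (hu (maxn N N')) => i /= h.
have -> : phi i - l = (phi i - u (maxn N N')) + (u (maxn N N') - l) by rewrite addrA subrK.
apply: Qp_absD_lt; last by apply: hN'; exact: leq_maxr.
by apply: lt_trans h (hN _ _); exact: leq_maxl.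
Qed.

End Padic.

(** * Escaping to infinity in a locally finite graph *)

(* A locally finite graph without finite components has a map [next] along its
   edges whose backward orbits are finite. Given a spanning forest (parents
   decrease [d]), a vertex whose subtree contains an infinite branch moves to a
   child of the same kind, any other vertex moves to its parent. *)
Lemma escape_map (V : eqType) (W : Type) (D : V -> Prop) (adj : V -> V -> Prop)
    (d : V -> nat) (root : V -> W) :
  (forall v w, adj v w -> D v /\ D w) ->
  (forall v w, adj v w -> adj w v) ->
  (forall v, exists s : seq V, forall w, adj v w -> w \in s) ->
  (forall v w, adj v w -> root w = root v) ->
  (forall v, D v -> (0 < d v)%N -> exists w, adj v w /\ (d w < d v)%N) ->
  (forall v w, D v -> D w -> d v = 0 -> d w = 0 -> root v = root w -> v = w) ->
  (forall v (s : seq V), D v -> exists w, [/\ D w, root w = root v & w \notin s]) ->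
  exists next : V -> V, (forall v, D v -> adj v (next v)) /\
    forall v, D v -> Acc (fun w v => D w /\ next w = v) v.
Proof.
move=> adjD adjC adj_fin adj_root desc d_root infinite.
have /choice[par hpar] : forall v, exists w, D v -> (0 < d v)%N ->
    adj v w /\ (d w < d v)%N.
  move=> v.
  have [h|h] := pselect (D v /\ (0 < d v)%N); last by exists v => ? ?; case: h.
  by have [w] := desc v h.1 h.2; exists w.
pose child w v := [/\ D w, (0 < d w)%N & par w = v].
(* Accessibility means that no infinite branch descends from [v]. *)
pose bad v := Acc child v.
have child_adj w v : child w v -> adj v w /\ (d v < d w)%N.
  by move=> [Dw dw <-]; have [/adjC] := hpar w Dw dw.
(* As in König's lemma, finitely many children and no infinite branch leave only finitely many
   descendants. *)
have descendants v : bad v -> exists s : seq V,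
    v \in s /\ forall u w, u \in s -> child w u -> w \in s.
  elim=> {}v _ IH.
  have [nb hnb] := adj_fin v.
  have /choice[f hf] : forall u, exists s : seq V, (child u v -> u \in s) /\
      forall x y, x \in s -> child y x -> y \in s.
    move=> u; have [h|h] := pselect (child u v); last by exists [::].
    by have [s [us hs]] := IH _ h; exists s.
  exists (v :: flatten (map f nb)); split; first exact: mem_head.
  move=> u w; rewrite !inE => /predU1P[->|/flattenP[_ /mapP[y ynb ->]] uf] cw.
    apply/orP; right; apply/flattenP; exists (f w); last exact: (hf w).1.
    by apply: map_f; apply: hnb; have [] := child_adj _ _ cw.
  apply/orP; right; apply/flattenP; exists (f y); first exact: map_f.
  exact: (hf y).2 uf cw.
(* Following parents, every vertex of the component reaches its only vertex of depth 0; finitely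
   many descendants of that vertex would exhaust an infinite component. *)
have good_root v : D v -> d v = 0 -> ~ bad v.
  move=> Dv dv0 /descendants [s [vs hs]].
  have [w [Dw rw /negP]] := infinite v s Dv; apply.
  have [n] := ubnP (d w); elim: n => // n IH in w Dw rw *; rewrite ltnS => dwn.
  have [dw0|dw] := posnP (d w); first by rewrite (d_root w v).
  have [aw lw] := hpar w Dw dw.
  apply: (hs (par w)) => //.
  apply: IH; [by have [] := adjD _ _ aw|by rewrite (adj_root _ _ aw)|].
  exact: leq_trans lw dwn.
have /choice[next hnext] : forall v, exists w, D v ->
    if `[< bad v >] then w = par v else child w v /\ ~ bad w.
  move=> v; case: asboolP => [_|nb]; first by exists (par v).
  have [[w hw]|h] := pselect (exists w, child w v /\ ~ bad w); first by exists w.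
  exfalso; apply: nb; constructor => w cw; apply: contrapT => nbw; apply: h.
  by exists w.
exists next; split=> [v Dv|].
  have := hnext v Dv; case: asboolP => [bv ->|_ [cv _]].
    have dv : (0 < d v)%N by rewrite lt0n; apply/eqP => /(good_root v Dv); exact.
    by have [] := hpar v Dv dv.
  by have [] := child_adj _ _ cv.
(* A vertex that is not bad moves to another such vertex, so a bad vertex is only reached from its
   bad children. *)
have bad_acc v : bad v -> Acc (fun w v => D w /\ next w = v) v.
  elim=> {}v bv IH; constructor => w [Dw nw].
  have := hnext w Dw; case: asboolP => [bw nwE|_ [_ nbn]]; last first.
    by exfalso; apply: nbn; rewrite nw; constructor.
  apply: IH; split => //; last by rewrite -nwE.
  by rewrite lt0n; apply/eqP => /(good_root w Dw); exact.
(* A preimage of [v] that is not bad is the parent of [v], hence strictly less deep; bad preimages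
   are settled by [bad_acc]. *)
move=> v; have [n] := ubnP (d v); elim: n v => [v|n IH v dvn Dv]; first by rewrite ltn0.
constructor => w [Dw nw].
have [bw|nbw] := pselect (bad w); first exact: bad_acc.
have := hnext w Dw; case: asboolP => [/nbw []|_ [cw _]].
apply: IH Dw; have [_] := child_adj _ _ cw; rewrite nw => dwv.
exact: leq_trans dwv dvn.
Qed.

(** * Invariant means and indices of open subgroups *)

Definition locconst (T : topologicalType) (X : Type) (f : T -> X) :=
  forall x, nbhs x (fun y => f y = f x).

Lemma nbhs_all_seq (T : topologicalType) (I : eqType) (s : seq I) (x : T)
    (E : I -> set T) :
  (forall i, i \in s -> nbhs x (E i)) ->
  nbhs x (fun y => forall i, i \in s -> E i y).
Proof.
elim: s => [|i s IH] h; first by apply: filterS filterT => y _ i; rewrite in_nil.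
have hs : nbhs x (fun y => forall i, i \in s -> E i y).
  by apply: IH => j js; apply: h; rewrite inE js orbT.
have hi := h i (mem_head _ _).
by apply: filterS (filterI hi hs) => y [yi ys] j; rewrite inE => /predU1P[->//|/ys].
Qed.

Section Means.
Variables (p : nat) (R : realType) (K : fieldType) (nK : K -> R).
Hypotheses (hp : prime p) (hK : is_Qp p nK).
Variables (G : topologicalType) (S : tdlc_group G).
Local Notation "x • y" := (gmul S x y) (at level 40, left associativity).
Local Notation inv := (ginv S).
Local Notation e := (gone S).

(** Natural numbers have p-adic absolute value at most 1, so even an unbounded count is a bounded
    function. The trajectory count used against noncompact generation depends on this. *)
Lemma Cb_nat (f : G -> nat) : locconst f -> Cb nK (fun x => (f x)%:R).
Proof.
move=> lf; split; last by exists 1 => x; exact: Qp_abs_nat_le1 hK _.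
move=> x eps eps0; exists (fun y => f y = f x); split; first exact: lf.
by move=> y ->; rewrite subrr (Qp_abs0 hK).
Qed.

Lemma Cb_cst (c : K) : Cb nK (fun _ : G => c).
Proof.
split; last by exists (nK c).
move=> x eps eps0; exists setT; split; first exact: filterT.
by move=> y _; rewrite subrr (Qp_abs0 hK).
Qed.

Lemma Cb_lin (a : K) (f g : G -> K) : Cb nK f -> Cb nK g ->
  Cb nK (fun x => a * f x + g x).
Proof.
move=> [cf [Bf hf]] [cg [Bg hg]]; split; last first.
  exists (Num.max (nK a * Bf) Bg) => x; apply: le_trans (Qp_ultra hK _ _) _.
  by rewrite (Qp_normM hK) ge_max !le_max hg orbT ler_wpM2l ?(Qp_ge0 hK).
move=> x eps eps0.
(* Adding 1 keeps the denominator positive when [a] is 0. *)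
have a1 : 0 < nK a + 1 by rewrite ltr_wpDl ?(Qp_ge0 hK).
have [|N [nN hN]] := cf x (eps / (nK a + 1)); first by rewrite divr_gt0.
have [N' [nN' hN']] := cg x eps eps0.
exists (N `&` N'); split; first exact: filterI.
move=> y [Ny N'y]; rewrite opprD addrACA -mulrBr.
apply: (Qp_absD_lt hK); last exact: hN'.
rewrite (Qp_normM hK); apply: (@le_lt_trans _ _ (nK a * (eps / (nK a + 1)))).
  by rewrite ler_wpM2l ?(Qp_ge0 hK) // ltW // hN.
by rewrite mulrCA gtr_pMr // ltr_pdivrMr // mul1r ltrDl.
Qed.

Lemma Cb_translate (g : G) (f : G -> K) : Cb nK f -> Cb nK (fun x => f (g • x)).
Proof.
move=> [cf [B hB]]; split; last by exists B.
move=> x eps eps0; have [N [nN hN]] := cf (g • x) eps eps0.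
by exists (fun y => N (g • y)); split; [exact: nbhs_gmull|move=> y /hN].
Qed.

Lemma supnorm_ub (f : G -> K) x : Cb nK f -> nK (f x) <= supnorm nK f.
Proof.
move=> [_ [B hB]]; apply: sup_upper_bound; last by exists x.
by split; [exists (nK (f x)), x|exists B => _ [y _ <-]].
Qed.

Lemma supnorm_le (f : G -> K) (B : R) : (forall x, nK (f x) <= B) ->
  supnorm nK f <= B.
Proof.
move=> hB; apply: ge_sup; first by exists (nK (f e)), e.
by move=> _ [x _ <-].
Qed.

Lemma supnorm_ge0 (f : G -> K) : Cb nK f -> 0 <= supnorm nK f.
Proof. by move=> /(supnorm_ub e); apply: le_trans; exact: (Qp_ge0 hK). Qed.

Section Mean.
Variable m : (G -> K) -> K.
Hypothesis hm : inv_mean S nK m.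

Lemma mean_lin a f g : Cb nK f -> Cb nK g ->
  m (fun x => a * f x + g x) = a * m f + m g.
Proof. by have [[h _] _] := hm; exact: h. Qed.

Lemma meanD f g : Cb nK f -> Cb nK g -> m (fun x => f x + g x) = m f + m g.
Proof.
move=> cf cg; rewrite -[m f]mul1r -mean_lin //; congr m; apply/funext => x.
by rewrite mul1r.
Qed.

Lemma mean0 : m (fun=> 0) = 0.
Proof.
have := meanD (Cb_cst 0) (Cb_cst 0).
by rewrite addr0 => /eqP; rewrite -[X in X == _]addr0 (inj_eq (addrI _)) => /eqP.
Qed.

Lemma mean1 : m (fun=> 1) = 1.
Proof. by have [[_ []]] := hm. Qed.

Lemma mean_translate g f : Cb nK f -> m (fun x => f (inv g • x)) = m f.
Proof. by have [_ h] := hm; exact: h. Qed.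

Lemma mean_sum (I : Type) (r : seq I) (F : I -> G -> K) :
  (forall i, Cb nK (F i)) ->
  m (fun x => \sum_(i <- r) F i x) = \sum_(i <- r) m (F i).
Proof.
move=> cF; suff [] : Cb nK (fun x => \sum_(i <- r) F i x) /\
  m (fun x => \sum_(i <- r) F i x) = \sum_(i <- r) m (F i) by [].
elim: r => [|i r [IH1 IH2]].
  rewrite big_nil (_ : (fun x => _) = fun=> 0); last first.
    by apply/funext => x; rewrite big_nil.
  by split; [exact: Cb_cst|exact: mean0].
rewrite big_cons (_ : (fun x => _) = fun x => F i x + \sum_(j <- r) F j x); last first.
  by apply/funext => x; rewrite big_cons.
rewrite meanD // IH2; split => //.
have := Cb_lin 1 (cF i) IH1; rewrite (_ : (fun x => 1 * _ + _) = fun x => F i x + \sum_(j <- r) F j x) //.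
by apply/funext => x; rewrite mul1r.
Qed.

(* The [n] left translates of [V T], for [T] a right transversal of [U],
   partition the group. *)
Lemma mean_index_bound (U V : set G) (n : nat) (C : R) :
  (forall f, Cb nK f -> nK (m f) <= C * supnorm nK f) ->
  open_subgroup S U -> open_subgroup S V -> V `<=` U -> index_eq S U V n ->
  (0 < n)%N /\ p%:R ^+ logn p n <= C.
Proof.
move=> mC oU oV VU [f [fU [finj fcov]]].
have [sU _] := oU; have [sV _] := oV.
have n0 : (0 < n)%N.
  by have [i _] := fcov _ (subgroup1 sU); exact: leq_ltn_trans (ltn_ord i).
split => //.
(* The values of [r] are the transversal, and [phi] is the indicator function of [V] times it. *)
pose r := crep S U.
pose phi x : nat := `[< V (x • inv (r x)) >].
have lphi : locconst phi.
  move=> x; apply: filterS (open_subgroup_rcoset x oV) => y Vyx.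
  rewrite /phi /r (crep_eq sU (VU _ Vyx)); congr (nat_of_bool _).
  apply/asbool_equiv_eq.
  have -> : y • inv (crep S U x) = (y • inv x) • (x • inv (crep S U x)) by rewrite !gE.
  exact: subgroupMl.
have C0 : Cb nK (fun x => (phi x)%:R) by exact: Cb_nat.
(* The element [x • inv (r x)] of [U] lies in exactly one left coset [f i V], which singles out one
   nonzero term. *)
have sum1 x : \sum_(i < n) (phi (inv (f i) • x))%:R = 1 :> K.
  have rE i : r (inv (f i) • x) = r x.
    by apply: crep_eq => //; rewrite gmulK; exact: subgroupV.
  have [i Vi] := fcov _ (crepV sU x).
  rewrite (bigD1 i) //= /phi rE -gmulA asboolT // big1 ?addr0 // => j ji.
  rewrite /phi rE -gmulA asboolF // => Vj; move/negP: ji; apply; apply/eqP.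
  apply: finj; have := subgroupM sV Vj (subgroupV sV Vi).
  by rewrite !gE.
have nphi : n%:R * m (fun x => (phi x)%:R) = 1.
  rewrite -[RHS]mean1 -[in RHS](_ : (fun x => \sum_(i < n) (phi (inv (f i) • x))%:R) = fun=> 1).
    rewrite (@mean_sum _ _ (fun i x => (phi (inv (f i) • x))%:R)); last first.
      by move=> i; apply: (Cb_translate _ C0).
    under eq_bigr do rewrite (mean_translate _ C0).
    by rewrite sumr_const card_ord mulr_natl.
  by apply/funext.
have := congr1 nK nphi; rewrite (Qp_normM hK) (Qp_abs1 hK) (Qp_abs_nat hK) // => E.
have pn0 : 0 < p%:R ^+ logn p n :> R by rewrite exprn_gt0 // ltr0n prime_gt0.
have <- : nK (m (fun x => (phi x)%:R)) = p%:R ^+ logn p n.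
  by apply: (mulfI (invr_neq0 (lt0r_neq0 pn0))); rewrite E mulVf ?lt0r_neq0.
have phi1 : supnorm nK (fun x => (phi x)%:R) <= 1.
  by apply: supnorm_le => x; exact: (Qp_abs_nat_le1 hK).
(* The constant function 1 has sup norm at least 1, so testing the bound on it excludes a negative
   [C]. *)
have C_ge0 : 0 <= C.
  have s1 : 1 <= supnorm nK (fun _ : G => 1).
    by rewrite -(Qp_abs1 hK); exact: (supnorm_ub e (Cb_cst 1)).
  rewrite -(pmulr_lge0 C (lt_le_trans ltr01 s1)).
  by apply: le_trans (mC _ (Cb_cst 1)); exact: (Qp_ge0 hK).
apply: le_trans (mC _ C0) _.
by rewrite -[leRHS]mulr1 ler_wpM2l.
Qed.

End Mean.
End Means.

(** * The coset graph of an open subgroup generated by a compact set *)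

Section Elliptic.
Variables (G : topologicalType) (S : tdlc_group G).
Local Notation "x • y" := (gmul S x y) (at level 40, left associativity).
Local Notation inv := (ginv S).
Local Notation e := (gone S).

(** A finite union of right translates of [U] is compact and contains the closed set [H]. *)
Lemma compact_rcosets (U H : set G) (s : seq G) : compact U -> closed H ->
  (forall x, H x -> exists2 t, t \in s & U (x • inv t)) -> compact H.
Proof.
move=> cU clH hs.
have cs : compact [set x | exists2 t, t \in s & U (x • inv t)].
  elim: s {hs} => [|t s IH].
    rewrite (_ : [set x | _] = set0); first exact: compact0.
    by rewrite -subset0 => x [t]; rewrite in_nil.
  rewrite (_ : [set x | _] = (fun y => y • t) @` U `|`
    [set x | exists2 t, t \in s & U (x • inv t)]).
    apply: compactU => //; apply: continuous_compact cU.
    by apply: continuous_subspaceT; exact: continuous_gmulr.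
  apply/seteqP; split => x /=.
    move=> [t']; rewrite inE => /predU1P[->|ts] h; last by right; exists t'.
    by left; exists (x • inv t) => //; rewrite !gE.
  move=> [[y Uy <-]|[t' ts h]]; first by exists t; rewrite ?mem_head ?gmulK.
  by exists t' => //; rewrite inE ts orbT.
exact: subclosed_compact clH cs hs.
Qed.

Section Generate.
Variables U Q : set G.
Hypothesis oU : open_subgroup S U.
Hypotheses (QV : forall x, Q x -> Q (inv x))
  (UQm : forall u x, U u -> Q x -> Q (u • x)).
Let sU := oU.1.

(** These are the product sets [Q^k U]. Starting from [U] instead of the identity makes word length
    a function on right cosets of [U], with value 0 on [U] alone. *)
Fixpoint Qpow (k : nat) : set G :=
  if k is k'.+1 then [set x | exists q y, [/\ Q q, Qpow k' y & x = q • y]] else U.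

Definition Qgen : set G := [set x | exists k, Qpow k x].

Lemma Qpow_mull k u x : U u -> Qpow k x -> Qpow k (u • x).
Proof.
case: k => [|k] Uu /=; first exact: subgroupM.
by move=> [q [y [Qq Qy ->]]]; exists (u • q), y; split; rewrite ?gmulA //; exact: UQm.
Qed.

Lemma QpowD j k x y : Qpow j x -> Qpow k y -> Qpow (j + k) (x • y).
Proof.
elim: j x => [|j IH] x; first exact: Qpow_mull.
move=> [q [z [Qq Qz ->]]] Qy; rewrite addSn /=; exists q, (z • y).
by split; rewrite ?gmulA //; exact: IH.
Qed.

Lemma Q_Qgen x : Q x -> Qgen x.
Proof.
by move=> Qx; exists 1, x, e; split; rewrite ?gmulg1 //; exact: subgroup1 sU.
Qed.

Lemma Qgen_open : open_subgroup S Qgen.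
Proof.
have UH x : U x -> Qgen x by exists 0.
have HM x y : Qgen x -> Qgen y -> Qgen (x • y).
  by move=> [j Qx] [k Qy]; exists (j + k)%N; exact: QpowD.
have sH : is_subgroup S Qgen.
  split; [exact: UH (subgroup1 sU)|split=> // x [k]].
  elim: k x => [|k IH] x /=; first by move=> Ux; apply: UH; exact: subgroupV.
  move=> [q [y [Qq Qy ->]]]; rewrite ginvM; apply: HM; first exact: IH.
  by apply: Q_Qgen; exact: QV.
apply: open_subgroup_of_nbhs => //.
exact: filterS UH (open_subgroup_nbhs oU).
Qed.

End Generate.

(** [Q] is the union of the double cosets [U a U] for [a] in [s']. Adding the identity and the
    inverses to [s] gives [U] inside [Q] and the symmetry of [Q]. *)
Lemma generating_set (U : set G) (s : seq G) :
  open_subgroup S U -> compact U ->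
  exists (Q : set G) (T : seq G), [/\ forall a, a \in s -> Q a, U `<=` Q,
    forall x, Q x -> Q (inv x),
    forall u x v, U u -> Q x -> U v -> Q (u • x • v) &
    uniq T /\ forall x, Q x -> exists2 t, t \in T & U (x • inv t)].
Proof.
move=> oU cU; have sU := oU.1.
pose s' := e :: s ++ map inv s.
pose Q := [set x | exists a u v, [/\ a \in s', U u, U v & x = u • a • v]].
(* By compactness, [a U] meets only finitely many right cosets of the open subgroup [U]. *)
have /choice[f hf] : forall a, exists r : seq G,
    forall v, U v -> exists2 t, t \in r & U (a • v • inv t).
  move=> a.
  have [|r [_ hr]] := compact_finite_cover (O := fun w v => U (a • v • inv (a • w))) cU.
    move=> w Uw; have h : nbhs (a • w) (fun y => U (y • inv (a • w))).
      exact: open_subgroup_rcoset.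
    exact: nbhs_gmull h.
  exists (map (gmul S a) r) => v /hr [w wr Uw]; exists (a • w) => //.
  exact: map_f.
exists Q, (undup (flatten (map f s'))); split.
- move=> a ra; exists a, e, e; split; rewrite ?gE //; try exact: subgroup1 sU.
  by rewrite inE mem_cat ra orbT.
- move=> u Uu; exists e, u, e; rewrite !gE; split => //; first exact: mem_head.
  exact: subgroup1 sU.
- move=> _ [a [u [v [ra Uu Uv ->]]]]; exists (inv a), (inv v), (inv u).
  rewrite !ginvM gmulA; split => //; try exact: subgroupV.
  move: ra; rewrite !inE !mem_cat => /or3P[/eqP ->|ra|/mapP[b br ->]].
  + by rewrite ginv1 eqxx.
  + by rewrite (map_f inv ra) !orbT.
  + by rewrite ginvK br orbT.
- move=> u _ v Uu [a [u' [v' [ra Uu' Uv' ->]]]] Uv.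
  exists a, (u • u'), (v' • v); split; rewrite ?gmulA //; exact: subgroupM.
split; first exact: undup_uniq.
move=> _ [a [u [v [ra Uu Uv ->]]]]; have [t ta Ut] := hf a v Uv.
exists t; first by rewrite mem_undup; apply/flattenP; exists (f a) => //; exact: map_f.
by have := subgroupM sU Uu Ut; rewrite !gmulA.
Qed.

(* If [Qgen] is not compact, the graph on [U \ G] joining [U x] to the cosets
   contained in [Q x] has only infinite components. *)
Lemma coset_escape (U Q : set G) (T : seq G) :
  open_subgroup S U -> compact U -> U `<=` Q ->
  (forall x, Q x -> Q (inv x)) ->
  (forall u x v, U u -> Q x -> U v -> Q (u • x • v)) ->
  (forall x, Q x -> exists2 t, t \in T & U (x • inv t)) ->
  ~ compact (Qgen U Q) ->
  exists next : G -> G,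
    (forall v, crep S U v = v -> crep S U (next v) = next v /\ Q (next v • inv v)) /\
    forall v, crep S U v = v ->
      Acc (fun w v => crep S U w = w /\ next w = v) v.
Proof.
move=> oU cU UQ QV QM QT ncH; have sU := oU.1.
have UQm u x : U u -> Q x -> Q (u • x).
  by move=> Uu Qx; rewrite -[_ • _](gmulg1 S); apply: QM => //; exact: subgroup1 sU.
have oH := Qgen_open oU QV UQm; have sH := oH.1.
set H := Qgen U Q in oH sH ncH.
have QH x : Q x -> H x by exact: Q_Qgen oU _.
have UH x : U x -> H x by move=> /UQ/QH.
pose rU := crep S U; pose rH := crep S H.
(* On [H], [dep] is the word length over [Q] modulo [U]; its values elsewhere are arbitrary. *)
have /choice[dep hdep] : forall x, exists k, H x ->
    Qpow U Q k x /\ forall j, Qpow U Q j x -> (k <= j)%N.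
  move=> x; have [Hx|] := pselect (H x); last by exists 0.
  have ex : exists k, `[< Qpow U Q k x >] by have [k hk] := Hx; exists k; exact/asboolP.
  exists (ex_minn ex) => _; case: ex_minnP => k /asboolP hk kmin; split => // j hj.
  by apply: kmin; exact/asboolP.
pose adj v w := [/\ rU v = v, rU w = w & Q (w • inv v)].
have adj_root v w : adj v w -> rH w = rH v.
  by move=> [_ _ /QH]; exact: crep_eq.
(* The coset representative [rH] labels the components, and the depth of [v] is its word length
   measured from [rH v]. *)
have [|||||||next [h1 h2]] := @escape_map G G (fun v => rU v = v) adj
    (fun v => dep (v • inv (rH v))) rH.
- by move=> v w [].
- by move=> v w [rv rw /QV]; rewrite !gE.
- move=> v; exists [seq rU (t • v) | t <- T] => w [rv rw /QT [t tT Ut]].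
  apply/mapP; exists t => //; rewrite -rw; apply: crep_eq => //.
  by move: Ut; rewrite !gE.
- exact: adj_root.
(* Removing the first letter [q] of a shortest word leads to a neighbor of smaller depth. *)
- move=> v rv; have [] := hdep _ (crepV sH v); rewrite -/rH.
  case: (dep _) => // k [q [y [Qq Qy E]]] _ _.
  pose w := rU (inv q • v).
  have Uw : U (w • inv (inv q • v)) by exact: crepP.
  have vw : adj v w.
    split => //; first exact: crep_id.
    have := UQm _ _ Uw (QV _ Qq); by rewrite !gE.
  exists w; split => //; rewrite ltnS; rewrite (adj_root _ _ vw).
  have hw : Qpow U Q k (w • inv (rH v)).
    have -> : w • inv (rH v) = (w • inv (inv q • v)) • (inv q • (v • inv (rH v))).
      by rewrite !gE.
    apply: Qpow_mull => //; first by rewrite E !gE.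
  by have [_] := hdep _ (ex_intro _ k hw : H _); apply.
- move=> v w rv rw v0 w0 rvw.
  have [] := hdep _ (crepV sH v); have [] := hdep _ (crepV sH w).
  rewrite -/rH v0 w0 /= => Uw _ Uv _; rewrite -rv -rw; apply: crep_eq => //.
  have := subgroupM sU Uv (subgroupV sU Uw); by rewrite rvw !gE.
(* A finite list exhausting a component would cover [H] by finitely many right cosets of [U] and
   make it compact. *)
- move=> v s rv; apply: contrapT => hn; apply: ncH.
  have clH := open_subgroup_closed oH.
  apply: (compact_rcosets (s := [seq w • inv (rH v) | w <- s]) cU clH) => h Hh.
  pose w := rU (h • rH v).
  have Uw : U (w • inv (h • rH v)) by exact: crepP.
  have ws : w \in s.
    apply: contrapT => /negP ws; apply: hn; exists w; split => //; first exact: crep_id.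
    have -> : rH w = rH (h • rH v) by apply: crep_eq => //; exact: UH.
    have -> : rH (h • rH v) = rH (rH v) by apply: crep_eq => //; rewrite gmulK.
    exact: crep_id.
  exists (w • inv (rH v)); first exact: map_f.
  by have := subgroupV sU Uw; rewrite !gE.
exists next; split=> // v rv; have [_ ? ?] := h1 v rv; by split.
Qed.

End Elliptic.

(** * Amenability implies local ellipticity *)

Section Amenable.
Variables (p : nat) (R : realType) (K : fieldType) (nK : K -> R).
Hypotheses (hp : prime p) (hK : is_Qp p nK).
Variables (G : topologicalType) (S : tdlc_group G).
Local Notation "x • y" := (gmul S x y) (at level 40, left associativity).
Local Notation inv := (ginv S).

(* [push N] transports the mass distribution [N] along [x |-> tau x • x]. *)
Section Push.
Variables (T : seq G) (tau : G -> G).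
Hypotheses (uT : uniq T) (tauT : forall x, tau x \in T) (ltau : locconst tau).

Definition push (N : G -> nat) (x : G) : nat :=
  (\sum_(t <- T) (tau (inv t • x) == t) * N (inv t • x))%N.

Lemma push_locconst N : locconst N -> locconst (push N).
Proof.
move=> lN x.
have h : nbhs x (fun y => forall t, t \in T ->
    tau (inv t • y) = tau (inv t • x) /\ N (inv t • y) = N (inv t • x)).
  apply: nbhs_all_seq => t _.
  apply: filterI; first exact: (nbhs_gmull (ltau _)).
  exact: (nbhs_gmull (lN _)).
apply: filterS h => y hy; apply: eq_big_seq => t /hy [-> ->] //.
Qed.

(** Split [N] into the pieces [g t] on which [tau] equals [t]. Pushing translates each piece by its
    own [t], so invariance applies piece by piece. *)
Lemma mean_push m N : inv_mean S nK m -> locconst N ->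
  m (fun x => (push N x)%:R) = m (fun x => (N x)%:R).
Proof.
move=> hm lN; pose g t x : nat := ((tau x == t) * N x)%N.
have Cg t : Cb nK (fun x => (g t x)%:R).
  apply: (Cb_nat hK) => x.
  by apply: filterS (filterI (ltau x) (lN x)) => y [ey1 ey2]; rewrite /g ey1 ey2.
transitivity (\sum_(t <- T) m (fun x => (g t (inv t • x))%:R)).
  rewrite -(@mean_sum _ _ _ _ hK _ S m hm _ _ (fun t x => (g t (inv t • x))%:R)); last first.
    by move=> t; exact: (Cb_translate _ _ (Cg t)).
  by congr m; apply/funext => x; rewrite /push natr_sum.
under eq_bigr do rewrite (mean_translate hm _ (Cg _)).
rewrite -(@mean_sum _ _ _ _ hK _ S m hm _ _ (fun t x => (g t x)%:R)) //; congr m; apply/funext => x.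
rewrite (bigD1_seq (tau x)) //= /g eqxx mul1n big1 ?addr0 // => t tx.
by rewrite eq_sym (negbTE tx).
Qed.

(* If locally the iterates of [push] kill the constant [1], their sum [N] is
   finite, bounded in the p-adic norm, and satisfies [N = push N + 1]. *)
Lemma push_not_nilpotent (D : G -> nat) m : inv_mean S nK m -> locconst D ->
  ~ (forall x k, (D x <= k)%N -> iter k push (fun=> 1) x = 0).
Proof.
move=> hm lD nil.
have lit k : locconst (iter k push (fun=> 1)).
  by elim: k => [|k IH] /=; [move=> x; exact: nearW|exact: push_locconst].
(* The [k]-th term counts the points that reach [x] after exactly [k] moves. *)
pose N x : nat := (\sum_(0 <= k < D x) iter k push (fun=> 1) x)%N.
have NE x M : (D x <= M)%N -> N x = (\sum_(0 <= k < M) iter k push (fun=> 1) x)%N.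
  move=> DM; rewrite (big_cat_nat (n := D x)) //= [X in (_ + X)%N]big1_seq ?addn0 // => k.
  by rewrite mem_index_iota => /andP[_ /andP[/nil]].
have lN : locconst N.
  move=> x; have h : nbhs x (fun y => forall k, k \in iota 0 (D x) ->
      iter k push (fun=> 1) y = iter k push (fun=> 1) x).
    by apply: nbhs_all_seq => k _; exact: lit.
  apply: filterS (filterI (lD x) h) => y [Dy hy]; rewrite /N Dy.
  by apply: eq_big_seq => k; rewrite mem_index_iota => kD; apply: hy; rewrite mem_iota.
have PN x : (push N x + 1)%N = N x.
  (* A cutoff valid at [x] and at all its possible preimages allows the two sums to be exchanged;
     the remaining term [k = 0] is the constant 1. *)
  pose M := maxn (D x) (\max_(t <- T) D (inv t • x)).
  rewrite (NE x M.+1); last by rewrite ltnW // ltnS leq_maxl.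
  rewrite big_nat_recl //= addnC; congr addn.
  transitivity (\sum_(t <- T) \sum_(0 <= k < M)
      (tau (inv t • x) == t) * iter k push (fun=> 1) (inv t • x))%N.
    apply: eq_big_seq => t tT; rewrite (NE _ M) ?big_distrr //.
    by rewrite leq_max leq_bigmax_seq ?orbT.
  by rewrite exchange_big.
have := mean_push hm lN.
have -> : (fun x => (N x)%:R) = (fun x => (push N x)%:R + 1 : K).
  by apply/funext => x; rewrite -PN natrD.
rewrite (meanD hm); [|exact/(Cb_nat hK)/push_locconst|exact: Cb_cst hK _ _].
rewrite (mean1 hm) => /eqP; rewrite -[X in X == _]addr0 (inj_eq (addrI _)).
by rewrite eq_sym oner_eq0.
Qed.

End Push.

(** The escape map on cosets is realized by left translations from the finite list [T]. Finiteness
    of backward orbits then makes the iterated push-forwards of 1 vanish locally, which an invariant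
    mean forbids. *)
Lemma amenable_locally_elliptic : padic_amenable S nK -> locally_elliptic S.
Proof.
move=> [m hm] A /finite_seqP[s ->].
have [U [oU cU _]] := van_Dantzig (S := S) (A := setT) filterT.
have sU := oU.1.
have [Q [T [sQ UQ QV QM [uT QT]]]] := generating_set s oU cU.
have UQm u x : U u -> Q x -> Q (u • x).
  by move=> Uu Qx; rewrite -[_ • _](gmulg1 S); apply: QM => //; exact: subgroup1 sU.
have oH := Qgen_open oU QV UQm.
exists (Qgen S U Q); split; [exact: oH.1|split; last first].
  by move=> a /= /sQ; exact: Q_Qgen oU _.
apply: contrapT => ncH.
have [next [h1 h2]] := coset_escape oU cU UQ QV QM QT ncH.
pose r := crep S U.
have rid x : r (r x) = r x by exact: crep_id.
(* The points [x] and [r x] differ by an element of [U], which [Q] absorbs on the right. *)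
have has_t x : has (fun t => r (t • x) == next (r x)) T.
  have [rn Qn] := h1 _ (rid x).
  have : Q (next (r x) • inv x).
    have := QM _ _ _ (subgroup1 sU) Qn (crepP sU x).
    by rewrite !gE.
  move=> /QT [t tT Ut]; apply/hasP; exists t => //; apply/eqP.
  by rewrite -rn; apply/esym; apply: crep_eq => //; move: Ut; rewrite !gE.
(* Taking the first suitable index makes [tau] depend only on [r x] and the cosets [r (t • x)],
   hence locally constant. *)
pose idx x := find (fun t => r (t • x) == next (r x)) T.
pose tau x := nth (gone S) T (idx x).
have tauT x : tau x \in T by apply: mem_nth; rewrite -has_find.
have tauE x : r (tau x • x) = next (r x) by apply/eqP; exact: (nth_find _ (has_t x)).
have lr : locconst r.
  by move=> x; apply: filterS (open_subgroup_rcoset x oU) => y; exact: crep_eq.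
have ltau : locconst tau.
  move=> x; have h : nbhs x (fun y => forall t, t \in T -> r (t • y) = r (t • x)).
    by apply: nbhs_all_seq => t _; exact: (nbhs_gmull (lr _)).
  apply: filterS (filterI (lr x) h) => y [ry hy]; rewrite /tau /idx; congr nth.
  by apply: eq_in_find => t tT; rewrite ry hy.
(* Well-founded induction turns accessibility into a bound on backward orbits: one more than the
   maximum over the finitely many neighboring cosets. *)
have /choice[L hL] : forall v, exists L, r v = v -> forall x k, r x = v ->
    (L <= k)%N -> iter k (push T tau) (fun=> 1) x = 0.
  move=> v; have [rv|] := pselect (r v = v); last by exists 0.
  elim: (h2 v rv) (rv) => {rv}v _ IH rv.
  have /choice[M hM] : forall w, exists M, next w = v -> r w = w ->
      forall x k, r x = w -> (M <= k)%N -> iter k (push T tau) (fun=> 1) x = 0.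
    move=> w; have [[rw nw]|h] := pselect (r w = w /\ next w = v); last first.
      by exists 0 => nw rw; case: h.
    by have [M hM] := IH w (conj rw nw) rw; exists M => _ _; exact: hM.
  pose nb := [seq r (t • v) | t <- T].
  exists (\max_(w <- nb) M w).+1 => _ x [//|k] rx; rewrite ltnS => Mk /=.
  rewrite /push big1_seq // => t /andP[_ tT].
  case: eqP => [tauy|]; last by rewrite mul0n.
  set y := inv t • x in tauy *; rewrite mul1n.
  have nry : next (r y) = v.
    by rewrite -tauE tauy /y !gE.
  apply: (hM (r y)) => //; apply: leq_trans Mk; apply: leq_bigmax_seq => //.
  have [_ /QV] := h1 _ (rid y); rewrite nry !gE => /QT [t' t'T Ut'].
  apply/mapP; exists t' => //; rewrite -[LHS]rid; apply: crep_eq => //.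
  by move: Ut'; rewrite !gE.
apply: (@push_not_nilpotent T tau uT tauT ltau (fun x => L (r x)) m hm).
  by move=> x; apply: filterS (lr x) => y ->.
by move=> x k; exact: (hL (r x) (rid x) x k erefl).
Qed.

End Amenable.

(** * Construction of an invariant mean *)

(** Greedy selection: an element is kept only if no element kept so far is related to it. Separation
    is stated on indices so that ordinals can number the coset representatives. *)
Lemma irredundant_subseq (T : eqType) (E : T -> T -> Prop) (s : seq T) :
  (forall x, E x x) -> (forall x y, E x y -> E y x) ->
  exists s' : seq T, [/\ {subset s' <= s},
    (forall t, t \in s -> exists2 t', t' \in s' & E t' t) &
    forall x0 i j, (i < size s')%N -> (j < size s')%N ->
      E (nth x0 s' i) (nth x0 s' j) -> i = j].
Proof.
move=> Er Es; elim: s => [|t s [s' [ss' cov inj]]]; first by exists [::].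
have [[t' t's' tt']|h] := pselect (exists2 t', t' \in s' & E t' t).
  exists s'; split => // [x /ss' xs|x]; first by rewrite inE xs orbT.
  by rewrite inE => /predU1P[->|/cov //]; exists t'.
exists (t :: s'); split.
- by move=> x; rewrite !inE => /predU1P[->|/ss' ->]; rewrite ?eqxx ?orbT.
- move=> x; rewrite inE => /predU1P[->|/cov [y ys' yx]]; first by exists t; rewrite ?mem_head.
  by exists y => //; rewrite inE ys' orbT.
- move=> x0 [|i] [|j] //= hi hj; last by move/(inj x0 _ _ hi hj) => ->.
    by move=> tE; case: h; exists (nth x0 s' j); [exact: mem_nth|exact: Es].
  by move=> Et; case: h; exists (nth x0 s' i); [exact: mem_nth|].
Qed.

Section Construction.
Variables (p : nat) (R : realType) (K : fieldType) (nK : K -> R).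
Hypotheses (hp : prime p) (hK : is_Qp p nK).
Variables (G : topologicalType) (S : tdlc_group G).
Local Notation "x • y" := (gmul S x y) (at level 40, left associativity).
Local Notation inv := (ginv S).
Local Notation e := (gone S).

(** [V] is the intersection of the conjugates of [V0] by elements of [H]; compactness of [H] keeps
    it a neighborhood of the identity. *)
Lemma normalized_open_subgroup (H W : set G) :
  is_subgroup S H -> compact H -> nbhs e W ->
  exists V, [/\ open_subgroup S V, V `<=` W &
    forall h v, H h -> V v -> V (h • v • inv h)].
Proof.
move=> sH cH nW; have [V0 [oV0 _ V0W]] := van_Dantzig nW; have sV0 := oV0.1.
pose V := [set x | forall h, H h -> V0 (h • x • inv h)].
have sV : is_subgroup S V.
  split; [|split].
  - by move=> h Hh; rewrite !gE; exact: subgroup1 sV0.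
  - move=> x y Vx Vy h Hh.
    have -> : h • (x • y) • inv h = (h • x • inv h) • (h • y • inv h) by rewrite !gE.
    by apply: subgroupM => //; [exact: Vx|exact: Vy].
  - move=> x Vx h Hh; have -> : h • inv x • inv h = inv (h • x • inv h) by rewrite !gE.
    by apply: subgroupV => //; exact: Vx.
exists V; split; last first.
- move=> h v Hh Vv h' Hh'.
  have -> : h' • (h • v • inv h) • inv h' = (h' • h) • v • inv (h' • h) by rewrite !gE.
  by apply: Vv; exact: subgroupM.
- by move=> x /(_ _ (subgroup1 sH)); rewrite !gE => /V0W.
apply: open_subgroup_of_nbhs => //.
have /compact_near_coveringP cH' := cH.
apply: (cH' _ (nbhs e) (fun x h => V0 (h • x • inv h))) => h Hh.
exists ([set h' | V0 (h' • inv h)], [set x | V0 (h • x • inv h)]); first split => /=.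
- exact: open_subgroup_rcoset.
- have n1 : nbhs (h • e) (fun y => V0 (y • inv h)).
    by rewrite gmulg1; exact: open_subgroup_rcoset.
  exact: nbhs_gmull n1.
move=> [h' x] [/= V0h V0x].
(* For [h'] close to [h], conjugation by [h'] is conjugation by [h] followed by conjugation by an
   element of [V0]. *)
have -> : h' • x • inv h' = (h' • inv h) • (h • x • inv h) • inv (h' • inv h) by rewrite !gE.
by apply: subgroupM => //; [exact: subgroupM|exact: subgroupV].
Qed.

Lemma uniform_continuity (H : set G) (f : G -> K) (eps : R) :
  compact H -> contK nK f -> 0 < eps ->
  nbhs e (fun w => forall h, H h -> nK (f (h • w) - f h) < eps).
Proof.
move=> /compact_near_coveringP cH cf eps0.
apply: (cH _ (nbhs e) (fun w h => nK (f (h • w) - f h) < eps)) => h Hh.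
have [N [nN hN]] := cf h eps eps0.
have [|[A B] [/= nA nB] AB] := @nbhs_gmul2 _ S h e N; first by rewrite gmulg1.
exists (N `&` A, B); first by split => //=; exact: filterI.
move=> [h' w] [/= [Nh' Ah'] Bw].
have -> : f (h' • w) - f h' = (f (h' • w) - f h) - (f h' - f h) by ring.
apply: (Qp_absD_lt hK); last by rewrite (Qp_absN hK); exact: hN.
by apply: hN; apply: (AB (h', w)).
Qed.

(** Here [U] is the product [H V], a subgroup because [H] normalizes [V]. Its coset representatives
    can be taken in [H], so the number of terms in an average over [H] is an index of open
    subgroups. *)
Lemma finite_index_data (H V : set G) :
  is_subgroup S H -> compact H -> open_subgroup S V ->
  (forall h v, H h -> V v -> V (h • v • inv h)) ->
  exists (U : set G) (n : nat) (u : 'I_n -> G), [/\ open_subgroup S U, V `<=` U &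
    index_eq S U V n] /\ [/\ forall i, H (u i),
    forall i j, V (inv (u i) • u j) -> i = j &
    forall h, H h -> exists i, V (inv (u i) • h)].
Proof.
move=> sH cH oV HV; have sV := oV.1.
have [s [sH' hs]] := compact_finite_cover cH (fun h _ => open_subgroup_lcoset h oV).
have [||s' [ss' cov inj]] := @irredundant_subseq _ (fun x y => V (inv x • y)) s.
- by move=> x; rewrite gmulV; exact: subgroup1 sV.
- by move=> x y /(subgroupV sV); rewrite !gE.
pose U := [set x | exists2 h, H h & V (inv h • x)].
have VU : V `<=` U by move=> v Vv; exists e; rewrite ?gE //; exact: subgroup1 sH.
have HV' h v : H h -> V v -> V (inv h • v • h).
  by move=> Hh Vv; have := HV _ _ (subgroupV sH Hh) Vv; rewrite ginvK.
pose u (i : 'I_(size s')) := nth e s' i.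
have Hu i : H (u i) by apply/sH'/ss'/mem_nth.
have uinj i j : V (inv (u i) • u j) -> i = j.
  by move/(inj e i j (ltn_ord _) (ltn_ord _))/val_inj.
have ucov h : H h -> exists i, V (inv (u i) • h).
  move=> /hs [t /cov [t' t's' tt'] th].
  have t's : (index t' s' < size s')%N by rewrite index_mem.
  exists (Ordinal t's); rewrite /u /= nth_index //.
  by have := subgroupM sV tt' th; rewrite !gE.
exists U, (size s'), u; split; last by split.
split => //.
- apply: open_subgroup_of_nbhs; last exact: filterS VU (open_subgroup_nbhs oV).
  split; first exact: VU _ (subgroup1 sV).
  split=> [x y [h Hh Vx] [h' Hh' Vy]|x [h Hh Vx]].
    exists (h • h'); first exact: subgroupM.
    by have := subgroupM sV (HV' _ _ Hh' Vx) Vy; rewrite !gE.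
  exists (inv h); first exact: subgroupV.
  by have := HV _ _ Hh (subgroupV sV Vx); rewrite !gE.
- exists u; split=> [i|]; first by exists (u i); rewrite ?gmulV //; exact: subgroup1 sV.
  split=> // x [h /ucov [i Vi] Vx]; exists i.
  by have := subgroupM sV Vi Vx; rewrite !gE.
Qed.

(** Finite averages satisfy linearity and normalization exactly and on all functions; only
    invariance is approximate, and it is tested on the finite list [L]. *)
Definition approx_mean (C eps : R) (L : seq (G * (G -> K))) : set ((G -> K) -> K) :=
  [set m | [/\ forall a f g, m (fun x => a * f x + g x) = a * m f + m g,
    m (fun=> 1) = 1,
    forall f, Cb nK f -> nK (m f) <= C * supnorm nK f &
    forall g f, (g, f) \in L -> Cb nK f ->
      nK (m (fun x => f (inv g • x)) - m f) <= eps]].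

(** The mean is the average over representatives [u i] of [H V / V]. Its norm is at most that of
    [1 / n], hence at most [p ^ k] by freeness. Translation by [g] permutes the cosets and moves
    each point only within its coset. *)
Lemma approx_mean_exists (k : nat) (eps : R) (L : seq (G * (G -> K))) :
  locally_elliptic S -> n_free S (p ^ k.+1) -> 0 < eps ->
  approx_mean (p%:R ^+ k) eps L !=set0.
Proof.
move=> eG pG eps0.
have pk0 : 0 < p%:R ^+ k :> R by rewrite exprn_gt0 // ltr0n prime_gt0.
have [H [sH [cH LH]]] := eG _ (finite_seq (map fst L)).
(* Dividing by [p ^ k] compensates for the absolute value of [1 / n]. *)
have nW : nbhs e (fun w => forall gf, gf \in L -> Cb nK gf.2 -> forall h, H h ->
    nK (gf.2 (h • w) - gf.2 h) < eps / p%:R ^+ k).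
  apply: nbhs_all_seq => gf _.
  have [cf|ncf] := pselect (Cb nK gf.2); last exact: nearW.
  have := uniform_continuity cH cf.1 (divr_gt0 eps0 pk0).
  by apply: filterS => w hw _.
have [V [oV VW HV]] := normalized_open_subgroup sH cH nW; have sV := oV.1.
have [U [n [u [[oU VU idx] [Hu uinj ucov]]]]] := finite_index_data sH cH oV HV.
have n0 : (0 < n)%N.
  by have [i _] := ucov _ (subgroup1 sH); exact: leq_ltn_trans (ltn_ord i).
have nabs : nK n%:R^-1 <= p%:R ^+ k.
  rewrite (Qp_absV hK) (Qp_abs_nat hK) // invrK ler_weXn2l ?ler1n ?prime_gt0 //.
  rewrite leqNgt; apply/negP => kn; apply: (pG _ _ _ oU oV VU idx).
  by rewrite pfactor_dvdn.
exists (fun f => n%:R^-1 * \sum_(i < n) f (u i)); split.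
- by move=> a f g; rewrite big_split /= -mulr_sumr mulrDr mulrCA.
- by rewrite sumr_const card_ord mulVf // (Qp_nat_neq0 hp hK).
- move=> f cf; rewrite (Qp_normM hK) ler_pM ?(Qp_ge0 hK) //.
  apply: (Qp_abs_sum hK); first exact: (supnorm_ge0 hK S cf).
  by move=> i _; exact: supnorm_ub.
move=> g f gfL cf.
have Hg : H g by apply: LH; apply/mapP; exists (g, f).
(* [sg] is the permutation of the cosets induced by [inv g]; reindexing by it pairs points of the
   same coset of [V]. *)
have /choice[sg hsg] : forall i, exists j, V (inv (u j) • (inv g • u i)).
  by move=> i; apply: ucov; apply: subgroupM => //; exact: subgroupV.
have sg_inj : injective sg.
  move=> i j E; apply: uinj; have := hsg j; rewrite -E => h.
  by have := subgroupM sV (subgroupV sV (hsg i)) h; rewrite !gE.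
rewrite [X in _ - _ * X](reindex_inj sg_inj) /= -mulrBr -sumrB (Qp_normM hK).
have -> : eps = p%:R ^+ k * (eps / p%:R ^+ k) by rewrite mulrCA divff ?mulr1 // gt_eqF.
rewrite ler_pM ?(Qp_ge0 hK) //.
apply: (Qp_abs_sum hK); first by rewrite ltW // divr_gt0.
move=> i _; have := VW _ (hsg i) _ gfL cf _ (Hu (sg i)).
by rewrite !gE /= => /ltW.
Qed.

Lemma Qp_small_eq0 (c : R) (x : K) : (forall eps, 0 < eps -> nK x <= c * eps) -> x = 0.
Proof.
move=> h; apply/(Qp_norm0 hK)/eqP; rewrite eq_le (Qp_ge0 hK) andbT leNgt.
apply/negP => x0.
have c1 : 0 < `|c| + 1 by rewrite ltr_wpDl.
have := h (nK x / (`|c| + 1)) (divr_gt0 x0 c1); apply/negP; rewrite -ltNge.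
rewrite mulrCA gtr_pMr // ltr_pdivrMr // mul1r.
by apply: le_lt_trans (ler_norm c) _; rewrite ltrDl.
Qed.

(** The sets of approximate means form a filter base, since tolerances can be minimized and lists
    concatenated. The mean takes each function to the limit of its values along a finer
    ultrafilter. *)
Lemma exists_inv_mean (k : nat) : locally_elliptic S -> n_free S (p ^ k.+1) ->
  exists2 m, inv_mean S nK m &
    forall f, Cb nK f -> nK (m f) <= p%:R ^+ k * supnorm nK f.
Proof.
move=> eG pG; pose C : R := p%:R ^+ k.
pose F := filter_from [set L : R * seq (G * (G -> K)) | 0 < L.1]
  (fun L => approx_mean C L.1 L.2).
have PF : ProperFilter F.
  apply: filter_from_proper; last by move=> [eps L] /= eps0; exact: approx_mean_exists.
  apply: filter_from_filter; first by exists (1, [::]); exact: ltr01.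
  move=> [e1 L1] [e2 L2] /= e1_gt0 e2_gt0.
  exists (Num.min e1 e2, L1 ++ L2); first by rewrite /= lt_min e1_gt0.
  move=> m /= [h1 h2 h3 h4]; split; split => // g f gfL cf.
    by apply: le_trans (h4 g f _ cf) _; rewrite ?mem_cat ?gfL // ge_min lexx.
  by apply: le_trans (h4 g f _ cf) _; rewrite ?mem_cat ?gfL ?orbT // ge_min lexx orbT.
have [UU [uU FU]] := ultraFilterLemma PF.
have good eps L : 0 < eps -> UU (approx_mean C eps L).
  by move=> eps0; apply: FU; exists (eps, L).
have /choice[M hM] : forall f, exists l, Cb nK f ->
    forall eps, 0 < eps -> UU [set m | nK (m f - l) < eps].
  move=> f; have [cf|] := pselect (Cb nK f); last by exists 0.
  have [|l hl] := Qp_ultra_lim hp hK (phi := fun m => m f) (C := C * supnorm nK f) uU.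
    by apply: filterS (good 1 [::] ltr01) => m [_ _ h _]; exact: h.
  by exists l.
(* The constant survives the limit unchanged: if [M f] exceeded the bound, some [m f] within the
   bound would be closer to [M f] than the size of [M f], against the ultrametric inequality. *)
have bound f : Cb nK f -> nK (M f) <= C * supnorm nK f.
  move=> cf; rewrite leNgt; apply/negP => h.
  have C0 : 0 <= C * supnorm nK f.
    by rewrite mulr_ge0 ?exprn_ge0 //; exact: (supnorm_ge0 hK S cf).
  have [m [/= h1 [_ _ h2 _]]] :=
    filter_ex (filterI (hM f cf _ (le_lt_trans C0 h)) (good 1 [::] ltr01)).
  have : nK (M f) < nK (M f).
    rewrite -{1}[M f](subKr (m f)) ; apply: (Qp_absD_lt hK).
      exact: le_lt_trans (h2 f cf) h.
    by rewrite (Qp_absN hK).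
  by rewrite ltxx.
exists M => //; split; [split; [|split]|].
(* A single approximate mean close to all three limits transfers exact linearity up to an error of
   [(nK a + 1) * eps]. *)
- move=> a f g cf cg.
  apply/eqP; rewrite -subr_eq0; apply/eqP.
  apply: (@Qp_small_eq0 (nK a + 1)) => eps eps0.
  have [m [[/= h0 [lin _ _ _]] [/= hf hg]]] := filter_ex (filterI
    (filterI (hM _ (Cb_lin hK a cf cg) _ eps0) (good 1 [::] ltr01))
    (filterI (hM f cf _ eps0) (hM g cg _ eps0))).
  have -> : M (fun x => a * f x + g x) - (a * M f + M g) =
    - (m (fun x => a * f x + g x) - M (fun x => a * f x + g x)) +
      (a * (m f - M f) + (m g - M g)) by rewrite lin; ring.
  have leps : eps <= (nK a + 1) * eps by rewrite ler_peMl ?lerDr ?(Qp_ge0 hK) // ltW.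
  apply: (Qp_absD_le hK); first by rewrite (Qp_absN hK) (le_trans (ltW h0)).
  apply: (Qp_absD_le hK); last by rewrite (le_trans (ltW hg)).
  rewrite (Qp_normM hK) ler_pM ?(Qp_ge0 hK) ?lerDl //; exact: ltW.
- by exists C.
- apply/eqP; rewrite -subr_eq0; apply/eqP.
  apply: (@Qp_small_eq0 1) => eps eps0.
  have [m [/= h0 [_ m1 _ _]]] :=
    filter_ex (filterI (hM _ (Cb_cst hK _ 1) _ eps0) (good 1 [::] ltr01)).
  by rewrite m1 in h0; rewrite mul1r (Qp_absC hK) ltW.
- move=> g f cf; apply/eqP; rewrite -subr_eq0; apply/eqP.
  apply: (@Qp_small_eq0 1) => eps eps0.
  have cgf : Cb nK (fun x => f (inv g • x)) by exact: Cb_translate.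
  have [m [[/= h1 h2] [_ _ _ /(_ g f (mem_head _ _) cf) h3]]] := filter_ex (filterI
    (filterI (hM _ cf _ eps0) (hM _ cgf _ eps0)) (good eps [:: (g, f)] eps0)).
  rewrite mul1r.
  set f' := fun x => f (inv g • x) in h2 h3 *.
  have -> : M f' - M f = (m f' - m f) + (m f - M f) - (m f' - M f') by ring.
  apply: (Qp_absD_le hK); last by rewrite (Qp_absN hK) ltW.
  by apply: (Qp_absD_le hK) => //; exact: ltW.
Qed.

End Construction.

(** * The operator norm and the main equivalence *)

Section OperatorNorm.
Variables (p : nat) (R : realType) (K : fieldType) (nK : K -> R).
Hypotheses (hp : prime p) (hK : is_Qp p nK).
Variables (G : topologicalType) (S : tdlc_group G).

Definition index_divisible (j : nat) : Prop :=
  exists U V n, open_subgroup S U /\ open_subgroup S V /\ V `<=` U /\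
    index_eq S U V n /\ (p ^ j %| n)%N.

(** The exponent 0 occurs through the index of the group in itself, and a bound for the mean limits
    every exponent that occurs. *)
Lemma index_divisible_max : padic_amenable S nK ->
  exists2 k, index_divisible k & forall j, index_divisible j -> (j <= k)%N.
Proof.
move=> [m hm]; have [[_ [[C mC] _]] _] := hm.
have [N CN] := exists_expn_gt hp C.
have bound j : `[< index_divisible j >] -> (j <= N)%N.
  move=> /asboolP [U [V [n [oU [oV [VU [idx pn]]]]]]].
  have [n0 nC] := mean_index_bound hp hK hm mC oU oV VU idx.
  have jn : (j <= logn p n)%N by rewrite -pfactor_dvdn.
  apply: leq_trans jn _; apply: ltnW.
  by rewrite -(@ltr_eXn2l R p%:R) ?ltr1n ?prime_gt1 //; exact: le_lt_trans nC CN.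
have ex : exists j, `[< index_divisible j >].
  exists 0%N; apply/asboolP; exists setT, setT, 1%N; split; first exact: open_subgroupT.
  split; first exact: open_subgroupT.
  split=> //; split; last by rewrite dvd1n.
  exists (fun=> gone S); split=> //; split=> [i j _|u _]; last by exists ord0.
  by rewrite !ord1.
case: (ex_maxnP ex bound) => k /asboolP hk kmax; exists k => // j hj.
by apply: kmax; exact/asboolP.
Qed.

Lemma opnorm_le m (C : R) : 0 <= C ->
  (forall f : G -> K, Cb nK f -> nK (m f) <= C * supnorm nK f) -> opnorm nK m <= C.
Proof.
move=> C0 hC; apply: ge_inf; last by split.
by exists 0 => x [].
Qed.

Lemma opnorm_ge k m : inv_mean S nK m -> index_divisible k ->
  p%:R ^+ k <= opnorm nK m.
Proof.
move=> hm [U [V [n [oU [oV [VU [idx pn]]]]]]].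
have [[_ [[C mC] _]] _] := hm.
apply: lb_le_inf.
  (* The infimum ranges over nonnegative constants, so the given [C] is replaced by its absolute
     value to show that it is taken over a nonempty set. *)
  exists `|C|; split => // f cf; apply: le_trans (mC f cf) _.
  by rewrite ler_wpM2r ?ler_norm //; exact: (supnorm_ge0 hK S cf).
move=> B [_ mB]; have [n0 nB] := mean_index_bound hp hK hm mB oU oV VU idx.
apply: le_trans nB; rewrite ler_weXn2l ?ler1n ?prime_gt0 //.
by rewrite -pfactor_dvdn.
Qed.

End OperatorNorm.

Theorem theorem1p9 (p : nat) (R : realType) (K : fieldType) (nK : K -> R)
  (hp : prime p) (hK : is_Qp p nK)
  (G : topologicalType) (S : tdlc_group G) :
  (padic_amenable S nK <-> locally_elliptic S /\ pN_free S p) /\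
  (padic_amenable S nK ->
    exists k : nat,
      (* k is the least with G p^(k+1)-free *)
      n_free S (p ^ k.+1) /\ (forall j, (j < k)%N -> ~ n_free S (p ^ j.+1)) /\
      (* p^k is the largest power of p dividing some index [U:V] *)
      (exists U V m, open_subgroup S U /\ open_subgroup S V /\ V `<=` U /\
         index_eq S U V m /\ (p ^ k %| m)%N) /\
      (forall U V m j, open_subgroup S U -> open_subgroup S V -> V `<=` U ->
         index_eq S U V m -> (p ^ j %| m)%N -> (j <= k)%N) /\
      normG S nK = ((p ^ k)%:R)%:E).
Proof.
have free_of_max k : (forall j, index_divisible p S j -> (j <= k)%N) ->
    n_free S (p ^ k.+1).
  move=> kmax U V n oU oV VU idx pn; suff : (k.+1 <= k)%N by rewrite ltnn.
  by apply: kmax; exists U, V, n.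
split.
  split=> [am|[eG [[|k] [// _ pG]]]].
    split; first exact: (amenable_locally_elliptic hK am).
    have [k _ /free_of_max pG] := index_divisible_max hp hK am.
    by exists k.+1.
  by have [m hm _] := exists_inv_mean hp hK eG pG; exists m.
move=> am; have [k hk kmax] := index_divisible_max hp hK am.
have pG := free_of_max k kmax.
exists k; split => //; split; [|split => //; split].
(* For [j < k], [p ^ j.+1] divides [p ^ k] and therefore an actual index. *)
- move=> j jk pGj; have [U [V [n [oU [oV [VU [idx pn]]]]]]] := hk.
  by apply: (pGj _ _ _ oU oV VU idx); apply: dvdn_trans pn; exact: dvdn_exp2l.
- by move=> U V n j oU oV VU idx pn; apply: kmax; exists U, V, n.
(* The constructed mean gives the upper bound for the infimum; the index divisible by [p ^ k] gives
   the lower bound for every invariant mean. *)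
have [m hm mle] := exists_inv_mean hp hK (amenable_locally_elliptic hK am) pG.
apply/eqP; rewrite eq_le natrX; apply/andP; split.
  apply: (@le_trans _ _ (opnorm nK m)%:E); first by apply: ereal_inf_lbound; exists m.
  by rewrite lee_fin; apply: opnorm_le => //; rewrite exprn_ge0.
apply: le_ereal_inf_tmp => _ [m' hm' <-].
by rewrite lee_fin; exact: (opnorm_ge hp hK hm' hk).
Qed.
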